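(* Let $\mathcal{C}$ be a super-modular category with $G_f$ symmetry fractionalization data $(\rho,\eta)$, where $G_f$ is determined by $\omega_2=(-1)^{\tilde\omega_2}\in Z^2(G_b,\mathbb{Z}_2)$, let $\check{\mathcal{C}}$ be a minimal modular extension of $\mathcal{C}$, and let $\check{\rho}_{\bf g}$, ${\bf g}\in G_b$, be autoequivalences of $\check{\mathcal{C}}$ restricting to $\rho_{\bf g}$ on $\mathcal{C}$ and such that $[\check{\rho}]$ has vanishing $\mathcal{H}^2$ obstruction, i.e. $[\check{\rho}]$ is a group homomorphism $G_b\to\mathrm{Aut}_{LR}(\check{\mathcal{C}})$ if $\check{\Upsilon}_\psi$ respects locality, and $[\check{\Upsilon}_\psi]^{\tilde\omega_2({\bf g,h})}[\check{\rho}_{\bf g}][\check{\rho}_{\bf h}]=[\check{\rho}_{\bf gh}]$ if $\check{\Upsilon}_\psi$ violates locality. Choose phases $\check{\beta}_a({\bf g,h})$ decomposing $\check{\kappa}_{\bf g,h}=\check{\rho}_{\bf gh}\check{\rho}_{\bf h}^{-1}\check{\rho}_{\bf g}^{-1}$, with $\check\beta_\psi=\omega_2$ if $\check{\Upsilon}_\psi$ violates locality, let $\beta_a=\check{\beta}_a$ for $a\in\mathcal{C}$, and let $\omega_a=\beta_a/\eta_a$ for $a\in\mathcal{C}$. Then: (i) for each ${\bf g,h}\in G_b$, $\omega_a({\bf g,h})\in K(\mathcal{C})$ extends to exactly two elements of $K(\check{\mathcal{C}})$, which differ by the factor $M_{a,\psi}$; (ii) for any choice of extensions $\check{\omega}_a\in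 C^2(G_b,K(\check{\mathcal{C}}))$ of $\omega_a$, there is $o_3\in Z^3(G_b,\mathbb{Z}_2)$, $\mathbb{Z}_2\simeq\{1,\psi\}$, with $\check{\Omega}_a({\bf g,h,k})\,\big((d\check{\omega})_a({\bf g,h,k})\big)^{-1}=M_{a,o_3({\bf g,h,k})}$ for all $a\in\check{\mathcal{C}}$, and the class $[o_3]\in\mathcal{H}^3(G_b,\mathbb{Z}_2)$ is independent of the choice of $\check{\omega}$; (iii) $[o_3]$ is trivial if and only if there exists an extension $\check{\omega}_a$ of $\omega_a$ with $\check{\Omega}_a=(d\check{\omega})_a$ for all $a\in\check{\mathcal{C}}$; equivalently, if and only if the symmetry fractionalization data $\eta_a$ on $\mathcal{C}$ can be extended to symmetry fractionalization data $\check{\eta}_a=\check{\beta}_a/\check{\omega}_a$ for $\check{\rho}$ on $\check{\mathcal{C}}$.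
   Context: A super-modular category $\mathcal{C}$ is a unitary braided fusion category with exactly one nontrivial simple object $\psi$ that braids trivially with all objects, where $\psi$ is a fermion: $\theta_\psi=-1$, $\psi\times\psi=1$. A minimal modular extension $\check{\mathcal{C}}$ is a UMTC containing $\mathcal{C}$ as a full braided fusion subcategory, with $\mathcal{D}_{\check{\mathcal{C}}}^2=2\mathcal{D}_{\mathcal{C}}^2$; $\mathcal{C}$ consists of the objects $a$ with double braid $M_{a,\psi}=+1$, and all other simple objects (fermion parity vortices) have $M_{a,\psi}=-1$. For Abelian $x$, $M_{a,x}\in\mathrm{U}(1)$ is the mutual braiding phase. Let $\mathcal{B}=\mathcal{C}$ or $\check{\mathcal{C}}$. A topological autoequivalence is a braided autoequivalence or (anti-unitary) braided anti-autoequivalence fixing $\psi$, acting on fusion vertices through matrices $U_{\bf g}(a,b;c)$: $\rho_{\bf g}|a,b;c;\mu\rangle=\sum_\nu U_{\bf g}({}^{\bf g}a,{}^{\bf g}b;{}^{\bf g}c)_{\mu\nu}|{}^{\bf g}a,{}^{\bf g}b;{}^{\bf g}c;\nu\rangle$, with ${}^{\bf g}a=\rho_{\bf g}(a)$, $\bar{\bf g}={\bf g}^{-1}$. A natural isomorphism acts by $|a,b;c;\mu\rangle\mapsto\frac{\gamma_a\gamma_b}{\gamma_c}|a,b;c;\mu\rangle$, $\gamma_a\in\mathrm{U}(1)$; it respects locality if it can be written with $\gamma_\psi=+1$ and violates locality otherwise. $\mathrm{Aut}_{LR}(\mathcal{B})$ is the group of topological autoequivalences with $U(\psi,\psi;1)=1$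 modulo locality-respecting natural isomorphisms. $\Upsilon_\psi$ on $\mathcal{C}$ (resp. $\check{\Upsilon}_\psi$ on $\check{\mathcal{C}}$) is the natural isomorphism with $\gamma_\psi=-1$ and $\gamma_a=1$ for all other $a$. $K(\mathcal{B})$ is the Abelian group of functions $\zeta$ from simple objects of $\mathcal{B}$ to $\mathrm{U}(1)$ with $\zeta_a\zeta_b=\zeta_c$ whenever $N_{ab}^c>0$. Known facts: $\check{\Upsilon}_\psi$ respects locality iff $\check{\mathcal{C}}$ contains an Abelian fermion parity vortex; $\Upsilon_\psi$ respects locality iff some minimal modular extension of $\mathcal{C}$ contains an Abelian fermion parity vortex; every $\zeta\in K(\mathcal{C})$ with $\zeta_\psi=+1$ has the form $\zeta_a=M_{a,x}$ with $x$ an Abelian anyon of $\mathcal{C}$. Symmetry fractionalization: each ${\bf g}\in G_b$ is unitary ($\sigma({\bf g})=1$) or anti-unitary ($\sigma({\bf g})=*$, complex conjugation). A symmetry action $\rho_{\bf g}$ determines natural isomorphisms $\kappa_{\bf g,h}=\rho_{\bf gh}\rho_{\bf h}^{-1}\rho_{\bf g}^{-1}$, written $\kappa_{\bf g,h}(a,b;c)=\frac{\beta_a({\bf g,h})\beta_b({\bf g,h})}{\beta_c({\bf g,h})}$, and $\Omega_a({\bf g,h,k})=\frac{\beta_{{}^{\bar{\bf g}}a}({\bf h,k})^{\sigma({\bf g})}\beta_a({\bf g,hk})}{\beta_a({\bf g,h})\beta_a({\bf gh,k})}$, which lies in $Z^3(G_b,K(\mathcal{B}))$. For $\omega\in C^2(G_b,K(\mathcal{B}))$,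 $(d\omega)_a({\bf g,h,k})=\frac{\omega_{{}^{\bar{\bf g}}a}({\bf h,k})^{\sigma({\bf g})}\omega_a({\bf g,hk})}{\omega_a({\bf g,h})\omega_a({\bf gh,k})}$. Symmetry fractionalization data are phases $\eta_a({\bf g,h})$ satisfying $\eta_{{}^{\bar{\bf g}}a}({\bf h,k})^{\sigma({\bf g})}\eta_a({\bf g,hk})=\eta_a({\bf g,h})\eta_a({\bf gh,k})$ and $\frac{\eta_c({\bf k,l})}{\eta_a({\bf k,l})\eta_b({\bf k,l})}U_{\bf kl}(a,b;c)=U_{\bf l}({}^{\bar{\bf k}}a,{}^{\bar{\bf k}}b;{}^{\bar{\bf k}}c)^{\sigma({\bf k})}U_{\bf k}(a,b;c)$ (up to convention); equivalently $\eta_a=\beta_a/\omega_a$ with $\omega\in C^2(G_b,K(\mathcal{B}))$ and $\Omega=d\omega$. On $\mathcal{C}$, $G_f$ symmetry fractionalization additionally requires $U_{\bf g}(\psi,\psi;1)=1$ and $\eta_\psi=\omega_2$. Checked quantities ($\check{\beta},\check{\Omega},\dots$) are those defined from $\check{\rho}$ on $\check{\mathcal{C}}$. *)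

(* Defs.v *)
From mathcomp Require Import all_boot all_order perm all_algebra.
From mathcomp Require Import reals complex.

Set Implicit Arguments.
Unset Strict Implicit.
Unset Printing Implicit Defensive.

Import Order.TTheory GRing.Theory Num.Theory.
Local Open Scope ring_scope.

(******************************************************************************)
(* Unitary braided fusion categories, in skeletal form.                       *)
(*                                                                            *)
(* [obj] is the set of isomorphism classes of simple objects.  Instead of     *)
(* one vertex space per triple of labels there is a single finite type [vtx]  *)
(* of basis vertices |a,b;c;mu>, and [bd |a,b;c;mu> = (a, b, c)]; thus N_ab^c *)
(* is the number of v with bd v = (a, b, c).  The labels of F- and R-symbols  *)
(* can then be read off from the vertices:                                    *)
(*   [F^{abc}_d]_{(e,alpha,beta)(f,mu,nu)} is Fsym alpha beta mu nu           *)
(*      alpha : ab -> e,  beta : ec -> d,  mu : bc -> f,  nu : af -> d        *)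
(*   [R^{ab}_c]_{mu nu}                    is Rsym mu nu                      *)
(*      mu : ba -> c,  nu : ab -> c                                           *)
(* Both symbols are extended by 0 to tuples of vertices that do not fit, so   *)
(* the pentagon and hexagon equations may be summed over all of vtx.          *)
(* [unitl a], [unitr a] and [cup a] are the basis vertices of the one-        *)
(* dimensional spaces |1,a;a>, |a,1;a> and |a,dual a;1>.                      *)
(******************************************************************************)

Definition in1 (L V : Type) (bd : V -> L * L * L) (v : V) : L := (bd v).1.1.
Definition in2 (L V : Type) (bd : V -> L * L * L) (v : V) : L := (bd v).1.2.
Definition out (L V : Type) (bd : V -> L * L * L) (v : V) : L := (bd v).2.

Definition F_fits (L : eqType) (V : Type) (bd : V -> L * L * L)
    (al be mu nu : V) : bool :=
  [&& out bd al == in1 bd be, out bd mu == in2 bd nu,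
      in1 bd al == in1 bd nu, in2 bd al == in1 bd mu,
      in2 bd be == in2 bd mu & out bd be == out bd nu].

Record ubfc (K : numClosedFieldType) := Ubfc {
  obj : finType;
  vtx : finType;
  bd : vtx -> obj * obj * obj;
  one : obj;
  dual : obj -> obj;
  unitl : obj -> vtx;
  unitr : obj -> vtx;
  cup : obj -> vtx;
  Fsym : vtx -> vtx -> vtx -> vtx -> K;
  Rsym : vtx -> vtx -> K;

  bd_unitl : forall a, bd (unitl a) = (one, a, a);
  unitl_uniq : forall v, in1 bd v = one -> v = unitl (in2 bd v);
  bd_unitr : forall a, bd (unitr a) = (a, one, a);
  unitr_uniq : forall v, in2 bd v = one -> v = unitr (in1 bd v);
  bd_cup : forall a, bd (cup a) = (a, dual a, one);
  cup_uniq : forall v, out bd v = one -> v = cup (in1 bd v);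

  F_supp : forall al be mu nu, Fsym al be mu nu != 0 -> F_fits bd al be mu nu;
  R_supp : forall mu nu, Rsym mu nu != 0 ->
    bd mu = (in2 bd nu, in1 bd nu, out bd nu);

  F_unitary1 : forall al be al' be', out bd al = in1 bd be ->
    \sum_mu \sum_nu Fsym al be mu nu * (Fsym al' be' mu nu)^*
      = ((al == al') && (be == be'))%:R;
  F_unitary2 : forall mu nu mu' nu', out bd mu = in2 bd nu ->
    \sum_al \sum_be (Fsym al be mu nu)^* * Fsym al be mu' nu'
      = ((mu == mu') && (nu == nu'))%:R;
  R_unitary1 : forall mu mu',
    \sum_nu Rsym mu nu * (Rsym mu' nu)^* = (mu == mu')%:R;
  R_unitary2 : forall nu nu',
    \sum_mu (Rsym mu nu)^* * Rsym mu nu' = (nu == nu')%:R;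

  F_unit1 : forall v w,
    Fsym (unitl (in1 bd v)) v w (unitl (out bd v)) = (v == w)%:R;
  F_unit2 : forall v w,
    Fsym (unitr (in1 bd v)) v (unitl (in2 bd v)) w = (v == w)%:R;
  F_unit3 : forall v w,
    Fsym v (unitr (out bd v)) (unitr (in2 bd v)) w = (v == w)%:R;

  pentagon : forall al be ga nu mu la,
    \sum_de Fsym be ga nu de * Fsym al de mu la =
    \sum_ps \sum_si \sum_rh
      Fsym al be ps si * Fsym si ga rh la * Fsym ps rh nu mu;
  hexagon : forall al be mu nu,
    \sum_la \sum_ga Rsym al la * Fsym la be ga nu * Rsym ga mu =
    \sum_de \sum_si \sum_ps
      Fsym al be de si * Rsym si ps * Fsym de ps mu nu;
  (* the same with every braiding replaced by its inverse, R^-1 = R^dagger *)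
  hexagon_inv : forall al be mu nu,
    \sum_la \sum_ga (Rsym la al)^* * Fsym la be ga nu * (Rsym mu ga)^* =
    \sum_de \sum_si \sum_ps
      Fsym al be de si * (Rsym ps si)^* * Fsym de ps mu nu;

  (* [F^{a (dual a) a}_a]_{11} != 0, i.e. dual a is a dual object of a *)
  rigid : forall a, Fsym (cup a) (unitl a) (cup (dual a)) (unitr a) != 0
}.

Arguments one {K} _.
Arguments bd {K} {_} _.

Section BraidedFusion.

Variables (K : numClosedFieldType) (B : ubfc K).

Definition src1 (v : vtx B) : obj B := in1 bd v.
Definition src2 (v : vtx B) : obj B := in2 bd v.
Definition tgt (v : vtx B) : obj B := out bd v.

Definition fusN (a b c : obj B) : nat := #|[pred v : vtx B | bd v == (a, b, c)]|.

(* d_a = |[F^{a (dual a) a}_a]_{11}|^-1 *)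
Definition qdim (a : obj B) : K :=
  `|Fsym (cup a) (unitl a) (cup (dual a)) (unitr a)|^-1.

(* the square of the total quantum dimension *)
Definition dimsq : K := \sum_a qdim a ^+ 2.

(* the double braid R^{ba} R^{ab} on each vertex space |a,b;c> *)
Definition dbraid (v w : vtx B) : K := \sum_u Rsym v u * Rsym u w.

Definition transparent (x : obj B) : Prop :=
  forall v w : vtx B, src1 v = x -> dbraid v w = (v == w)%:R.

(* theta_a = \sum_c (d_c / d_a) tr R^{aa}_c *)
Definition twist (a : obj B) : K :=
  \sum_(v | (src1 v == a) && (src2 v == a)) qdim (tgt v) / qdim a * Rsym v v.

(* The quantum trace \sum_c d_c tr (R^{ba}_c R^{ab}_c) of the double braid,   *)
(* divided by D.  Conventions with the dual of a in place of a differ by a    *)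
(* permutation of the rows.                                                   *)
Definition Smat (a b : obj B) : K :=
  (sqrtC dimsq)^-1 *
  \sum_(v | (src1 v == a) && (src2 v == b)) qdim (tgt v) * dbraid v v.

Definition modular : Prop :=
  forall a b : obj B, \sum_c Smat a c * (Smat b c)^* = (a == b)%:R.

(* M_{a,x}, for x Abelian only: the sum has then a single term, at the unique *)
(* vertex with incoming labels a and x.                                       *)
Definition mutual (a x : obj B) : K :=
  \sum_(v | (src1 v == a) && (src2 v == x)) dbraid v v.

Definition super_modular (psi : obj B) : Prop :=
  [/\ psi != one B,
      forall x, transparent x <-> x = one B \/ x = psi,
      twist psi = -1
    & forall c, fusN psi psi c = (c == one B)].

Definition phases (z : obj B -> K) : Prop := forall a, `|z a| = 1.

(* membership in the group K(B) *)
Definition inK (z : obj B -> K) : Prop :=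
  phases z /\
  forall a b c, (0 < fusN a b c)%N -> z a * z b = z c.

(* The action of a (possibly anti-unitary) autoequivalence rho on labels and  *)
(* vertices: rho |v> = \sum_w umx v w |w>.  If bd v = (a, b, c), then w runs  *)
(* over the vertices with boundary (rho a, rho b, rho c) and umx v w is       *)
(* U(rho a, rho b; rho c)_{v w}: the labels of U are those of its column      *)
(* index.                                                                     *)
Record autodata := AutoData {
  anti : bool;
  lab : {perm obj B};
  umx : vtx B -> vtx B -> K
}.

Definition bd_lab (p : {perm obj B}) (v : vtx B) : obj B * obj B * obj B :=
  (p (src1 v), p (src2 v), p (tgt v)).

(* z^sigma: complex conjugation if the flag s is set *)
Definition sgm (s : bool) (z : K) : K := if s then z^* else z.

Record topological_autoeq (psi : obj B) (r : autodata) : Prop :=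
 TopologicalAutoeq {
  lab_psi : lab r psi = psi;
  lab_one : lab r (one B) = one B;
  umx_supp : forall v w, umx r v w != 0 -> bd w = bd_lab (lab r) v;
  umx_unitary1 : forall v v',
    \sum_w umx r v w * (umx r v' w)^* = (v == v')%:R;
  umx_unitary2 : forall w w',
    \sum_v (umx r v w)^* * umx r v w' = (w == w')%:R;
  umx_unitl : forall a, umx r (unitl a) (unitl (lab r a)) = 1;
  umx_unitr : forall a, umx r (unitr a) (unitr (lab r a)) = 1;
  umx_F : forall al be mu' nu',
    \sum_al' \sum_be' umx r al al' * umx r be be' * Fsym al' be' mu' nu' =
    \sum_mu \sum_nu
      sgm (anti r) (Fsym al be mu nu) * umx r mu mu' * umx r nu nu';
  umx_R : forall mu nu',
    \sum_mu' umx r mu mu' * Rsym mu' nu' =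
    \sum_nu sgm (anti r) (Rsym mu nu) * umx r nu nu'
}.

Definition same_action (r r' : autodata) : Prop :=
  [/\ anti r = anti r', lab r = lab r'
    & forall v w, umx r v w = umx r' v w].

(* auto_comp r r' is r after r'; products of permutations are read from left   *)
(* to right.                                                                  *)
Definition auto_comp (r r' : autodata) : autodata :=
  AutoData (anti r (+) anti r') (lab r' * lab r)%g
    (fun v w => \sum_u sgm (anti r) (umx r' v u) * umx r u w).

Definition auto_inv (r : autodata) : autodata :=
  AutoData (anti r) (lab r)^-1%g (fun v w => sgm (anti r) (umx r w v)^*).

Definition natiso (ga : obj B -> K) : autodata :=
  AutoData false 1%g
    (fun v w => (v == w)%:R * (ga (src1 v) * ga (src2 v) / ga (tgt v))).

Definition upsilon (psi : obj B) : autodata :=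
  natiso (fun a => if a == psi then -1 else 1).

Definition upsilon_exp (psi : obj B) (n : bool) : autodata :=
  if n then upsilon psi else natiso (fun=> 1).

(* for r a natural isomorphism *)
Definition respects_locality (psi : obj B) (r : autodata) : Prop :=
  exists ga, [/\ phases ga, ga psi = 1 & same_action r (natiso ga)].

(* [r] = [r'] in Aut_LR(B) *)
Definition eq_AutLR (psi : obj B) (r r' : autodata) : Prop :=
  exists ga,
    [/\ phases ga, ga psi = 1 & same_action r (auto_comp (natiso ga) r')].

Section SymmetryAction.

Variable G : groupType.
Implicit Types (rho : G -> autodata) (x eta : G -> G -> obj B -> K).

Definition kappa rho (g h : G) : autodata :=
  auto_comp (auto_comp (rho (g * h)%g) (auto_inv (rho h))) (auto_inv (rho g)).

(* kappa_{g,h}(a,b;c) = beta_a(g,h) beta_b(g,h) / beta_c(g,h) *)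
Definition decomposes_kappa rho x : Prop :=
  forall g h, phases (x g h) /\ same_action (kappa rho g h) (natiso (x g h)).

(* This is Omega for x = beta, and d omega for x = omega. *)
Definition d2 rho x (g h k : G) (a : obj B) : K :=
  sgm (anti (rho g)) (x h k (lab (rho g^-1%g) a)) * x g (h * k)%g a
    / (x g h a * x (g * h)%g k a).

(* The second equation of symmetry fractionalization data is stated for the   *)
(* matrix entry (v, w), where bd w = (a, b, c).                               *)
Definition sym_frac rho eta : Prop :=
  [/\ forall g h, phases (eta g h),
      forall g h k a,
        sgm (anti (rho g)) (eta h k (lab (rho g^-1%g) a)) * eta g (h * k)%g a
        = eta g h a * eta (g * h)%g k a
    & forall k l v w,
        eta k l (tgt w) / (eta k l (src1 w) * eta k l (src2 w))
          * umx (rho (k * l)%g) v w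
        = \sum_u sgm (anti (rho k)) (umx (rho l) v u) * umx (rho k) u w].

(* Group homomorphism G -> Z_2 (anti-unitarity) together with an action of G  *)
(* on the labels by autoequivalences.                                         *)
Definition symmetry_action (psi : obj B) rho : Prop :=
  [/\ forall g, topological_autoeq psi (rho g),
      forall g h, anti (rho (g * h)%g) = anti (rho g) (+) anti (rho h)
    & forall g h a, lab (rho (g * h)%g) a = lab (rho g) (lab (rho h) a)].

Definition Gf_sym_frac (psi : obj B) (w2 : G -> G -> bool) rho eta : Prop :=
  [/\ symmetry_action psi rho,
      sym_frac rho eta,
      forall g, umx (rho g) (cup psi) (cup psi) = 1
    & forall g h, eta g h psi = (-1) ^+ w2 g h].

(* vanishing of the H^2 obstruction of [rho] *)
Definition vanishing_H2 (psi : obj B) (w2 : G -> G -> bool) rho : Prop :=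
  (respects_locality psi (upsilon psi) ->
     forall g h,
       eq_AutLR psi (auto_comp (rho g) (rho h)) (rho (g * h)%g)) /\
  (~ respects_locality psi (upsilon psi) ->
     forall g h,
       eq_AutLR psi
         (auto_comp (upsilon_exp psi (w2 g h)) (auto_comp (rho g) (rho h)))
         (rho (g * h)%g)).

End SymmetryAction.

End BraidedFusion.

(* Cochains of a group with values in the trivial module Z_2 = (bool, xor).   *)
Section Z2Cochains.

Variable G : groupType.

Definition Z2_cocycle2 (w : G -> G -> bool) : Prop :=
  forall g h k : G,
    w h k (+) w (g * h)%g k (+) w g (h * k)%g (+) w g h = false.

Definition Z2_cocycle3 (o : G -> G -> G -> bool) : Prop :=
  forall g h k l : G,
    o h k l (+) o (g * h)%g k l (+) o g (h * k)%g l (+) o g h (k * l)%g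
      (+) o g h k = false.

Definition Z2_coboundary3 (o : G -> G -> G -> bool) : Prop :=
  exists z : G -> G -> bool, forall g h k : G,
    o g h k = z h k (+) z (g * h)%g k (+) z g (h * k)%g (+) z g h.

Definition Z2_cohomologous3 (o o' : G -> G -> G -> bool) : Prop :=
  Z2_coboundary3 (fun g h k => o g h k (+) o' g h k).

End Z2Cochains.

Section Extensions.

Variables (K : numClosedFieldType) (C X : ubfc K).

(* C as a full braided fusion subcategory of X, the bases of the vertex       *)
(* spaces of X being chosen to extend those of C.                             *)
Record full_subcat := FullSubcat {
  emb :> obj C -> obj X;
  embv : vtx C -> vtx X;
  emb_inj : injective emb;
  embv_inj : injective embv;
  emb_one : emb (one C) = one X;
  emb_bd : forall v, bd (embv v) = (emb (src1 v), emb (src2 v), emb (tgt v));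
  emb_full : forall a b (w : vtx X),
    src1 w = emb a -> src2 w = emb b -> exists v, w = embv v;
  emb_F : forall al be mu nu,
    Fsym (embv al) (embv be) (embv mu) (embv nu) = Fsym al be mu nu;
  emb_R : forall mu nu, Rsym (embv mu) (embv nu) = Rsym mu nu
}.

Definition minimal_modular_ext (i : full_subcat) : Prop :=
  modular X /\ dimsq X = 2%:R * dimsq C.

Variable i : full_subcat.

Definition restricts_action (r' : autodata X) (r : autodata C) : Prop :=
  [/\ anti r' = anti r,
      forall a, lab r' (i a) = i (lab r a)
    & forall v w, umx r' (embv i v) (embv i w) = umx r v w].

Definition extends (z' : obj X -> K) (z : obj C -> K) : Prop :=
  forall a, z' (i a) = z a.

Variable G : groupType.

(* omega_a = beta_a / eta_a for a in C, where beta is the restriction of beta' *)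
Definition omega_of (beta' : G -> G -> obj X -> K) (eta : G -> G -> obj C -> K)
    (g h : G) (a : obj C) : K :=
  beta' g h (i a) / eta g h a.

(* x' is an element of C^2(G, K(X)) extending x *)
Definition K_extension (x : G -> G -> obj C -> K)
    (x' : G -> G -> obj X -> K) : Prop :=
  forall g h, inK (x' g h) /\ extends (x' g h) (x g h).

(* Omega'_a (d omega')_a^-1 = M_{a,o(g,h,k)}, with true standing for psi *)
Definition is_o3 (psi : obj C) (rho' : G -> autodata X)
    (beta' omega' : G -> G -> obj X -> K) (o : G -> G -> G -> bool) : Prop :=
  Z2_cocycle3 o /\
  forall g h k a,
    d2 rho' beta' g h k a * (d2 rho' omega' g h k a)^-1
    = mutual a (if o g h k then i psi else one X).

End Extensions.

(* Main.v *)
Require Import Defs.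
From mathcomp Require Import all_boot all_order perm all_algebra.
From mathcomp Require Import boolp ring reals complex.

Set Implicit Arguments.
Unset Strict Implicit.
Unset Printing Implicit Defensive.

Import Order.TTheory GRing.Theory Num.Theory.
Local Open Scope ring_scope.

(* Omega on X and d(omega') are K(X)-valued 3-cocycles that agree on C, since  *)
(* eta solves the fractionalization equations there; so everything reduces to  *)
(* restricting K(X) to C: the kernel of this restriction is {1, M_{-,psi}},    *)
(* and every zeta in K(C) with zeta_psi = 1 lies in its image.                 *)
(*                                                                            *)
(* Kernel: by unitarity of S, the objects braiding trivially with psi carry    *)
(* half of the total dimension of X, so they are those of C; the product of    *)
(* two objects outside C lies in C.                                            *)
(*                                                                            *)
(* Image: by the Verlinde formula and orthogonality of the characters of the   *)
(* fusion ring of C, the x with S_{cx} proportional to zeta_c d_c satisfy      *)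
(* sum d_x^2 = dim X / dim C = 2, and this set is stable under psi.  If        *)
(* psi x <> x this forces d_x = 1 and zeta = M_{-,x}; psi x = x would          *)
(* contradict theta_psi = -1, because x braids trivially with psi.  If         *)
(* omega_psi = -1, then upsilon respects locality and K(X) has an element      *)
(* taking the value -1 at psi, which reduces omega to the previous case.       *)
(*                                                                            *)
(* The spherical structure behind the quantum traces is derived from the       *)
(* pentagon and unitarity: with L the operator bending a leg and rho the       *)
(* rotation of a vertex, L L^dagger is a block scalar times conj(rho)^3;       *)
(* being positive, it equals d_c / (d_a d_b).                                  *)

(** * Matrices indexed by a finite type *)

(** Everything reduces to restricting characters from K(X) to K(C). On C both [beta'] and [eta]
    compare the action of gh with the product of those of g and h, so omega = beta'/eta is a
    character ([om_inK]); since eta is closed, Omega' and d omega agree on C ([d2_beta_emb]). What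
    remains is the kernel and the image of restriction: [kernel_character] finds the kernel {1,
    M_{-,psi}}, and [extend_character] extends every character equal to 1 at psi. [om_extends]
    handles omega_psi = -1 with a character of X equal to -1 at psi, which exists because upsilon
    then respects locality. This gives (i).

    For (ii), Omega' ([d2_inK]) and d omega' ([d2_cochain_inK]) are characters of X with equal
    restrictions, so their ratio is a power [chi o] of M_{-,psi}. These powers are signs invariant
    under the symmetry ([mutual_lab]), so dd = 1 ([d3d2]) makes o an ordinary Z_2-cocycle. Another
    extension multiplies omega' by [chi z] and shifts o by dz ([d2_chi]). For (iii), a cochain z
    with dz = o is exactly the correction of omega' that is required, and [extension_sym_frac]
    rephrases Omega' = d omega' as the equations for eta' = beta'/omega'.

    The extension lemma counts dimensions with the S-matrix. The columns of S which are proportional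
    to zeta on C have total squared dimension 2, by [verlinde] and unitarity of S; psi permutes them
    without fixed points by [fermion_not_fixed], so they belong to Abelian objects. The Verlinde
    formula is a weighted trace of [monodromy], evaluated by [F_partial_trace], which in turn rests
    on the Gram matrix [kerK_gram] of leg bending. *)

Lemma big_single (R : nmodType) (I : finType) (i : I) (F : I -> R) :
  (forall j, F j != 0 -> j = i) -> \sum_j F j = F i.
Proof.
move=> h; rewrite (bigD1 i) //= big1 ?addr0 // => j ne_ji.
by apply/eqP; apply: contraNT ne_ji => /h ->.
Qed.

Section LabelledMatrix.

Variables (K : numClosedFieldType) (T : finType).
Implicit Types (f g : T -> T -> K) (A B : 'M[K]_#|T|).

Definition lmx f : 'M[K]_#|T| := \matrix_(i, j) f (enum_val i) (enum_val j).
Definition entry A (x y : T) : K := A (enum_rank x) (enum_rank y).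
Definition dmx (d : T -> K) : 'M[K]_#|T| := lmx (fun x y => d x *+ (x == y)).
Definition cmx A : 'M[K]_#|T| := map_mx Num.conj A.
Definition hmx A : 'M[K]_#|T| := (cmx A)^T.

Lemma entry_lmx f x y : entry (lmx f) x y = f x y.
Proof. by rewrite /entry mxE !enum_rankK. Qed.

Lemma entry_inj A B : (forall x y, entry A x y = entry B x y) -> A = B.
Proof.
move=> h; apply/matrixP => i j.
by have := h (enum_val i) (enum_val j); rewrite /entry !enum_valK.
Qed.

Lemma entry_mul A B x y :
  entry (A *m B) x y = \sum_z entry A x z * entry B z y.
Proof.
rewrite /entry mxE (reindex (@enum_rank T)) //.
by apply: onW_bij; apply: enum_rank_bij.
Qed.

Lemma entry_cmx A x y : entry (cmx A) x y = (entry A x y)^*.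
Proof. by rewrite /entry mxE. Qed.

Lemma entry_tr A x y : entry A^T x y = entry A y x.
Proof. by rewrite /entry mxE. Qed.

Lemma entry_hmx A x y : entry (hmx A) x y = (entry A y x)^*.
Proof. by rewrite entry_tr entry_cmx. Qed.

Lemma entry_dmx (d : T -> K) x y : entry (dmx d) x y = d x *+ (x == y).
Proof. exact: entry_lmx. Qed.

Lemma entry_dmul (d : T -> K) A x y : entry (dmx d *m A) x y = d x * entry A x y.
Proof.
rewrite entry_mul (bigD1 x) //= big1 ?addr0 ?entry_dmx ?eqxx // => z.
by rewrite entry_dmx eq_sym => /negbTE ->; rewrite mul0r.
Qed.

Lemma entry_muld (d : T -> K) A x y : entry (A *m dmx d) x y = entry A x y * d y.
Proof.
rewrite entry_mul (bigD1 y) //= big1 ?addr0 ?entry_dmx ?eqxx // => z.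
by rewrite entry_dmx => /negbTE ->; rewrite mulr0.
Qed.

Lemma entry_trace A : \tr A = \sum_x entry A x x.
Proof.
rewrite /mxtrace (reindex (@enum_rank T)) //.
by apply: onW_bij; apply: enum_rank_bij.
Qed.

Lemma dmx1 : dmx (fun=> 1) = 1%:M.
Proof.
apply/matrixP => i j; rewrite !mxE; case: eqP => [/enum_val_inj -> | ne].
  by rewrite eqxx.
by case: eqP => // eij; case: ne; rewrite eij.
Qed.

Lemma entry1 x y : entry 1%:M x y = (x == y)%:R.
Proof. by rewrite -dmx1 entry_dmx. Qed.

Lemma eq_dmx (d e : T -> K) : d =1 e -> dmx d = dmx e.
Proof. by move=> h; apply: entry_inj => x y; rewrite !entry_dmx h. Qed.

Lemma dmx_mul (d e : T -> K) : dmx d *m dmx e = dmx (fun x => d x * e x).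
Proof.
apply: entry_inj => x y; rewrite entry_dmul !entry_dmx.
by rewrite mulrnAr.
Qed.

Lemma dmx_comm (d e : T -> K) A :
  (forall x y, entry A x y != 0 -> e x = d y) -> A *m dmx d = dmx e *m A.
Proof.
move=> h; apply: entry_inj => x y; rewrite entry_muld entry_dmul mulrC.
by have [->|/h ->] := eqVneq (entry A x y) 0; rewrite ?mulr0.
Qed.

Lemma cmxM A B : cmx (A *m B) = cmx A *m cmx B.
Proof. exact: map_mxM. Qed.

Lemma cmxK A : cmx (cmx A) = A.
Proof. by apply/matrixP=> i j; rewrite !mxE conjCK. Qed.

Lemma cmx_tr A : cmx A^T = (cmx A)^T.
Proof. by apply/matrixP=> i j; rewrite !mxE. Qed.

Lemma cmx1 : cmx 1%:M = 1%:M.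
Proof. exact: map_mx1. Qed.

Lemma cmx_dmx (d : T -> K) : cmx (dmx d) = dmx (fun x => (d x)^*).
Proof.
by apply: entry_inj => x y; rewrite entry_cmx !entry_dmx; case: eqP;
  rewrite ?rmorph0.
Qed.

Lemma tr_dmx (d : T -> K) : (dmx d)^T = dmx d.
Proof.
apply: entry_inj => x y; rewrite entry_tr !entry_dmx eq_sym.
by case: eqP => // ->.
Qed.

Lemma hmxM A B : hmx (A *m B) = hmx B *m hmx A.
Proof. by rewrite /hmx cmxM trmx_mul. Qed.

Lemma hmxK A : hmx (hmx A) = A.
Proof. by rewrite /hmx cmx_tr trmxK cmxK. Qed.

Lemma hmx_dmx (d : T -> K) : hmx (dmx d) = dmx (fun x => (d x)^*).
Proof. by rewrite /hmx cmx_dmx tr_dmx. Qed.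

(* N = A A^dagger - P is Hermitian and N (A A^dagger + P) = 0, so that the     *)
(* nonnegative diagonal entries of N A A^dagger N^dagger + N P N^dagger vanish. *)
Lemma psd_sqrt_unique A (p : T -> K) :
  (forall x, 0 < p x) ->
  (A *m hmx A) *m dmx p = dmx p *m (A *m hmx A) ->
  (A *m hmx A) *m (A *m hmx A) = dmx (fun x => p x ^+ 2) ->
  A *m hmx A = dmx p.
Proof.
move=> p0; set H := A *m hmx A => comm sq.
pose N := H - dmx p.
have Hh : hmx H = H by rewrite /H hmxM hmxK.
have hN : N *m (H + dmx p) = 0.
  rewrite /N mulmxBl !mulmxDr sq -comm dmx_mul.
  rewrite opprD addrA addrK.
  by apply/eqP; rewrite subr_eq0; apply/eqP/eq_dmx => x; rewrite expr2.
have e0 : (N *m A) *m hmx (N *m A) + N *m dmx p *m hmx N = 0.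
  rewrite hmxM !mulmxA -(mulmxA N) -/H -!mulmxDl -mulmxDr.
  by rewrite hN mul0mx.
suff N0 : N = 0 by apply/eqP; rewrite -subr_eq0; apply/eqP.
apply: entry_inj => x y; rewrite {2}/entry mxE.
have : entry ((N *m A) *m hmx (N *m A) + N *m dmx p *m hmx N) x x = 0.
  by rewrite e0 /entry mxE.
rewrite {1}/entry mxE -!/(entry _ x x) !entry_mul.
have t1 z : 0 <= entry (N *m A) x z * entry (hmx (N *m A)) z x.
  by rewrite entry_hmx mul_conjC_ge0.
have t2 z : 0 <= entry (N *m dmx p) x z * entry (hmx N) z x.
  by rewrite entry_hmx entry_muld mulrAC mulr_ge0 ?mul_conjC_ge0 // ltW.
move/eqP; rewrite paddr_eq0 ?sumr_ge0 // => /andP[_].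
rewrite psumr_eq0 // => /allP/(_ y); rewrite mem_index_enum => /(_ isT).
rewrite entry_hmx entry_muld mulrAC mulf_eq0 (gt_eqF (p0 y)) orbF.
by rewrite mul_conjC_eq0 => /eqP.
Qed.

End LabelledMatrix.

(** * Rigidity and quantum dimensions *)

Section Rigidity.

Variables (K : numClosedFieldType) (B : ubfc K).
Implicit Types (a b c x : obj B) (al be ga mu nu la ps si rh v w : vtx B).
Local Notation in1 := (@in1 (obj B) (vtx B) bd).
Local Notation in2 := (@in2 (obj B) (vtx B) bd).
Local Notation out := (@out (obj B) (vtx B) bd).
Local Notation F := (@Fsym K B).
Local Notation one := (@Defs.one K B).

Lemma F_labels al be mu nu : F al be mu nu != 0 ->
  [/\ out al = in1 be, out mu = in2 nu, in1 al = in1 nu &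
   [/\ in2 al = in1 mu, in2 be = in2 mu & out be = out nu]].
Proof.
by case/F_supp/and5P => /eqP-> /eqP-> /eqP-> /eqP-> /andP[/eqP-> /eqP->].
Qed.

Lemma in1_unitl a : in1 (unitl a) = one.
Proof. by rewrite /Defs.in1 bd_unitl. Qed.
Lemma in2_unitl a : in2 (unitl a) = a.
Proof. by rewrite /Defs.in2 bd_unitl. Qed.
Lemma out_unitl a : out (unitl a) = a.
Proof. by rewrite /Defs.out bd_unitl. Qed.
Lemma in1_unitr a : in1 (unitr a) = a.
Proof. by rewrite /Defs.in1 bd_unitr. Qed.
Lemma in2_unitr a : in2 (unitr a) = one.
Proof. by rewrite /Defs.in2 bd_unitr. Qed.
Lemma out_unitr a : out (unitr a) = a.
Proof. by rewrite /Defs.out bd_unitr. Qed.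
Lemma in1_cup a : in1 (cup a) = a.
Proof. by rewrite /Defs.in1 bd_cup. Qed.
Lemma in2_cup a : in2 (cup a) = dual a.
Proof. by rewrite /Defs.in2 bd_cup. Qed.
Lemma out_cup a : out (cup a) = one.
Proof. by rewrite /Defs.out bd_cup. Qed.

Definition labE := (in1_unitl, in2_unitl, out_unitl, in1_unitr, in2_unitr,
  out_unitr, in1_cup, in2_cup, out_cup).

Lemma in1_one v a : in1 v = one -> in2 v = a -> v = unitl a.
Proof. by move=> /unitl_uniq -> <-; rewrite labE. Qed.
Lemma in1_one_out v a : in1 v = one -> out v = a -> v = unitl a.
Proof. by move=> /unitl_uniq ->; rewrite labE => ->. Qed.
Lemma in2_one v a : in2 v = one -> in1 v = a -> v = unitr a.
Proof. by move=> /unitr_uniq -> <-; rewrite labE. Qed.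
Lemma in2_one_out v a : in2 v = one -> out v = a -> v = unitr a.
Proof. by move=> /unitr_uniq ->; rewrite labE => ->. Qed.
Lemma out_one v a : out v = one -> in1 v = a -> v = cup a.
Proof. by move=> /cup_uniq -> <-; rewrite labE. Qed.

Lemma dualK : involutive (@dual K B).
Proof. by move=> a; have /F_labels[_ _ _ [_]] := rigid a; rewrite !labE => <-. Qed.

Lemma unitl1 : unitl (one) = unitr (one).
Proof. by apply: in2_one; rewrite labE. Qed.

(** The zig-zag scalar: its modulus is 1/d_a and, for self-dual [a], its phase is the
    Frobenius-Schur indicator. *)
Definition rigidF a : K := F (cup a) (unitl a) (cup (dual a)) (unitr a).
(* [kerK] and [kerL] bend the right, resp. left, incoming leg of a vertex up;  *)
(* [rot] rotates a vertex by a third of a turn, (a, b; c) to (b, c'; a').     *)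
Definition kerK mu ga := F mu ga (cup (in2 mu)) (unitr (in1 mu)).
Definition kerL mu ga := F (cup (dual (in1 mu))) (unitl (in2 mu)) mu ga.
Definition rot mu nu := F mu (cup (out mu)) nu (cup (in1 mu)).

Lemma kerK_labels mu ga : kerK mu ga != 0 ->
  [/\ in1 ga = out mu, in2 ga = dual (in2 mu) & out ga = in1 mu].
Proof. by case/F_labels=> -> _ _ [_ ->]; rewrite !labE. Qed.

Lemma kerL_labels mu ga : kerL mu ga != 0 ->
  [/\ in1 ga = dual (in1 mu), in2 ga = out mu & out ga = in2 mu].
Proof. by case/F_labels=> _ -> <- [_ _ <-]; rewrite !labE. Qed.

Lemma rot_labels mu nu : rot mu nu != 0 ->
  [/\ in1 nu = in2 mu, in2 nu = dual (out mu) & out nu = dual (in1 mu)].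
Proof. by case/F_labels=> _ -> _ [-> <- _]; rewrite !labE. Qed.

Lemma F_triangle1 v w a b : in1 v = a -> out v = b ->
  F (unitl a) v w (unitl b) = (v == w)%:R.
Proof. by move=> <- <-; apply: F_unit1. Qed.
Lemma F_triangle2 v w a b : in1 v = a -> in2 v = b ->
  F (unitr a) v (unitl b) w = (v == w)%:R.
Proof. by move=> <- <-; apply: F_unit2. Qed.
Lemma F_triangle3 v w a b : out v = a -> in2 v = b ->
  F v (unitr a) (unitr b) w = (v == w)%:R.
Proof. by move=> <- <-; apply: F_unit3. Qed.

Lemma F_triangle2w v w : F (unitr (in1 w)) v (unitl (in2 w)) w = (v == w)%:R.
Proof.
have [F0|/F_labels] := eqVneq (F (unitr (in1 w)) v (unitl (in2 w)) w) 0.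
  case: (eqVneq v w) F0 => [->|_ -> //].
  by rewrite F_unit2 eqxx => /eqP; rewrite oner_eq0.
by rewrite !labE => -[e1 _ _ [_ e2 _]]; apply: F_triangle2.
Qed.

Lemma pentagonl al be ga nu mu la :
  \sum_de F be ga nu de * F al de mu la = \sum_ps \sum_si
    F al be ps si * (\sum_rh F si ga rh la * F ps rh nu mu).
Proof.
rewrite pentagon; apply: eq_bigr => ps _; apply: eq_bigr => si _.
rewrite big_distrr /=; apply: eq_bigr => rh _. by rewrite -mulrA.
Qed.

Lemma pentagonr al be ga nu mu la :
  \sum_de F be ga nu de * F al de mu la = \sum_ps \sum_rh
    (\sum_si F al be ps si * F si ga rh la) * F ps rh nu mu.
Proof.
rewrite pentagon; apply: eq_bigr => ps _; rewrite exchange_big.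
by apply: eq_bigr => rh _; rewrite big_distrl.
Qed.

(** Unitarity inverts F on composable pairs. The hypothesis is asked only where F is nonzero, since
    only there are the labels of [al] and [be] known. *)
Lemma F_projl mu nu (H G : vtx B -> vtx B -> K) : out mu = in2 nu ->
  (forall al be, F al be mu nu != 0 ->
     H al be = \sum_ps \sum_si F al be ps si * G ps si) ->
  \sum_al \sum_be (F al be mu nu)^* * H al be = G mu nu.
Proof.
move=> e h; transitivity (\sum_al \sum_be \sum_ps \sum_si
    ((F al be mu nu)^* * F al be ps si) * G ps si).
  apply: eq_bigr => al _; apply: eq_bigr => be _.
  have [->|/h->] := eqVneq (F al be mu nu) 0.
    rewrite rmorph0 mul0r big1 // => ps _; rewrite big1 // => si _.
    by rewrite !mul0r.
  rewrite big_distrr; apply: eq_bigr => ps _; rewrite big_distrr.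
  by apply: eq_bigr => si _; rewrite [LHS]mulrA.
under eq_bigr => al _ do rewrite exchange_big /=.
rewrite exchange_big (big_single (i := mu)) => [|ps].
  under eq_bigr => al _ do rewrite exchange_big /=.
  rewrite exchange_big (big_single (i := nu)) => [|si].
    under eq_bigr => al _ do rewrite -big_distrl /=.
    by rewrite -big_distrl F_unitary2 //= !eqxx mul1r.
  apply: contraNeq => ne.
  under eq_bigr => al _ do rewrite -big_distrl /=.
  by rewrite -big_distrl F_unitary2 //= (eq_sym nu) (negbTE ne) andbF mul0r.
apply: contraNeq => ne.
under eq_bigr => al _ do rewrite exchange_big /=.
rewrite exchange_big big1 // => si _.
under eq_bigr => al _ do rewrite -big_distrl /=.
by rewrite -big_distrl F_unitary2 //= (eq_sym mu) (negbTE ne) mul0r.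
Qed.

Lemma F_projr al be (H G : vtx B -> vtx B -> K) : out al = in1 be ->
  (forall mu nu, F al be mu nu != 0 ->
     H mu nu = \sum_ps \sum_rh G ps rh * F ps rh mu nu) ->
  \sum_mu \sum_nu H mu nu * (F al be mu nu)^* = G al be.
Proof.
move=> e h; transitivity (\sum_mu \sum_nu \sum_ps \sum_rh
    G ps rh * (F al be mu nu * (F ps rh mu nu)^*)^*).
  apply: eq_bigr => mu _; apply: eq_bigr => nu _.
  have [->|/h->] := eqVneq (F al be mu nu) 0.
    rewrite rmorph0 mulr0 big1 // => ps _; rewrite big1 // => si _.
    by rewrite !mul0r rmorph0 mulr0.
  rewrite big_distrl; apply: eq_bigr => ps _; rewrite big_distrl.
  by apply: eq_bigr => si _;
    rewrite rmorphM /= conjCK -mulrA (mulrC (F ps si mu nu)).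
under eq_bigr => mu _ do rewrite exchange_big /=.
have un ps rh : \sum_mu \sum_nu
    G ps rh * (F al be mu nu * (F ps rh mu nu)^*)^*
    = G ps rh * ((al == ps) && (be == rh))%:R.
  under eq_bigr => mu _ do rewrite -big_distrr /= -rmorph_sum.
  by rewrite -big_distrr -rmorph_sum F_unitary1 //= rmorph_nat.
rewrite exchange_big (big_single (i := al)) => [|ps].
  under eq_bigr => mu _ do rewrite exchange_big /=.
  rewrite exchange_big (big_single (i := be)) => [|rh].
    by rewrite un !eqxx mulr1.
  by apply: contraNeq => ne; rewrite un (eq_sym be) (negbTE ne) andbF mulr0.
apply: contraNeq => ne.
under eq_bigr => mu _ do rewrite exchange_big /=.
rewrite exchange_big big1 // => si _.
by rewrite un (eq_sym al) (negbTE ne) mulr0.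
Qed.

Lemma pentagon_cup al be ga la : out al = in1 be ->
  kerK be ga *+ (al == la) = \sum_ps \sum_si F al be ps si *
    (\sum_rh F si ga rh la * F ps rh (cup (in2 be)) (unitr (in2 al))).
Proof.
move=> e_al; rewrite -pentagonl (big_single (i := unitr (in1 be))); last first.
  move=> de; rewrite mulf_eq0 negb_or => /andP[/F_labels[_ + + _] _].
  by rewrite labE => e1 e2; apply: in2_one.
by rewrite (F_triangle3 _ e_al) // /kerK mulr_natr.
Qed.

(** Bending a leg up and back straightens a zig-zag, at the cost of its scalar: the pentagon for
    strands a, b, [dual b], b with inner pairs fused to 1. *)
Lemma kerK_rigid la ga :
  \sum_be (kerK la be)^* * kerK be ga = rigidF (in2 la) *+ (la == ga).
Proof.
have e : out (cup (in2 la)) = in2 (unitr (in1 la)) by rewrite !labE.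
pose G ps si := \sum_rh F si ga rh la *
   F ps rh (cup (dual (in2 la))) (unitr (in2 la)).
transitivity (G (cup (in2 la)) (unitr (in1 la))); last first.
  rewrite /G (big_single (i := unitl (in2 la))) => [|rh].
    by rewrite F_triangle2w eq_sym mulr_natl.
  rewrite mulf_eq0 negb_or => /andP[_ /F_labels[+ _ _ [_ _ +]]].
  by rewrite !labE => e1 e2; apply: in1_one_out.
rewrite -(F_projl (H := fun al be => kerK be ga *+ (al == la)) e).
  rewrite [RHS](big_single (i := la)) => [|al].
    by apply: eq_bigr => be _; rewrite eqxx.
  by apply: contraNeq => /negbTE ->; rewrite big1 // => be _; rewrite mulr0.
move=> al be /F_labels[e1 _ _ [e2 e3 _]].
by rewrite pentagon_cup // e2 e3 !labE.
Qed.

Lemma kerL_rigid ga la :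
  \sum_mu (kerL ga mu)^* * kerL mu la = rigidF (in1 ga) *+ (ga == la).
Proof.
set a := in1 ga; pose d := in2 ga.
have e : out (cup (dual a)) = in1 (unitl d) by rewrite !labE.
pose G ps rh := \sum_si F (cup a) (unitl a) ps si * F si ga rh la.
pose H nu mu := \sum_de F (unitl a) ga nu de * F (cup a) de mu la.
transitivity (G (cup (dual a)) (unitl d)); last first.
  rewrite /G (big_single (i := unitr a)) => [|si].
    by rewrite F_triangle2 // mulr_natr.
  rewrite mulf_eq0 negb_or => /andP[/F_labels[_ + + _] _].
  by rewrite !labE => /esym e1 /esym e2; apply: in2_one.
rewrite -(F_projr (H := H) e) => [|nu mu _]; last exact: pentagonr.
have HE nu mu :
    H nu mu = (ga == nu)%:R * F (cup a) (unitl (out ga)) mu la.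
  rewrite /H (big_single (i := unitl (out ga))) ?F_unit1 // => de.
  rewrite mulf_eq0 negb_or => /andP[/F_labels[_ _ + [_ _ +]] _].
  by rewrite labE => e1 e2; apply: in1_one_out.
rewrite [RHS](big_single (i := ga)) => [|nu]; last first.
  apply: contraNeq => ne; rewrite big1 // => mu _.
  by rewrite HE eq_sym (negbTE ne) !mul0r.
apply: eq_bigr => mu _; rewrite HE eqxx mul1r mulrC.
change (F (cup (dual a)) (unitl d) ga mu) with (kerL ga mu).
have [->|/kerL_labels[e1 e2 _]] := eqVneq (kerL ga mu) 0.
  by rewrite rmorph0 !mulr0.
by rewrite /kerL e1 e2 dualK.
Qed.

(** Together with [rot_kerK] this ties both bendings to the rotation, which is what makes the Gram
    matrix of [kerL] computable. *)
Lemma kerL_rot mu ga : \sum_si kerL mu si * rot si ga = (kerK mu ga)^*.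
Proof.
set a := in1 mu; set b := in2 mu.
pose G ps rh := \sum_si F (cup (dual a)) (unitl b) ps si *
   F si (cup b) rh (cup (dual a)).
pose H nu la := \sum_de F (unitl b) (cup b) nu de *
  F (cup (dual a)) de la (cup (dual a)).
have [e|ne] := eqVneq (out mu) (in1 ga); last first.
  rewrite big1 => [|si _].
    apply: esym; have [->|/kerK_labels[e _ _]] := eqVneq (kerK mu ga) 0.
      by rewrite rmorph0.
    by rewrite e eqxx in ne.
  apply/eqP; apply: contraNT ne; rewrite mulf_eq0 negb_or.
  by move=> /andP[/kerL_labels[_ <- _] /rot_labels[-> _ _]].
transitivity (G mu ga).
  apply: eq_bigr => si _.
  have [e0|/kerL_labels[e1 _ e2]] := eqVneq (kerL mu si) 0;
    last by rewrite /rot e1 e2.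
  by rewrite -/(kerL mu si) e0 !mul0r.
rewrite -(F_projr (H := H) e) => [|nu la _]; last exact: pentagonr.
have HE nu la :
    H nu la = ((cup b == nu) && (unitr a == la))%:R.
  rewrite /H (big_single (i := unitl one)) => [|de]; last first.
    rewrite mulf_eq0 negb_or => /andP[/F_labels[_ _ + [_ _ +]] _].
    by rewrite !labE => e1 e2; apply: in1_one_out.
  rewrite F_triangle1 ?labE // unitl1.
  have [->|ne] := eqVneq la (unitr a).
    by rewrite F_triangle3 ?labE ?dualK // !eqxx andbT mulr1.
  rewrite andbF; have [->|/F_labels] :=
      eqVneq (F (cup (dual a)) (unitr one) la (cup (dual a))) 0.
    by rewrite mulr0.
  rewrite !labE dualK => -[_ _ _ [/esym e1 /esym e2 _]].
  by rewrite (in2_one e2 e1) eqxx in ne.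
rewrite (big_single (i := cup b)) => [|nu]; last first.
  apply: contraNeq => ne; rewrite big1 // => la _.
  by rewrite HE (eq_sym _ nu) (negbTE ne) mul0r.
rewrite (big_single (i := unitr a)) => [|la]; last first.
  apply: contraNeq => ne.
  by rewrite HE (eq_sym _ la) (negbTE ne) andbF mul0r.
by rewrite HE !eqxx mul1r.
Qed.

Lemma rot_kerK mu nu :
  \sum_al \sum_be (kerK al be)^* * (rot be nu * rot al mu) = kerL nu mu.
Proof.
pose b := dual (in1 nu); pose a := dual (out mu).
have e : out (cup b) = in2 (unitr a) by rewrite !labE.
pose H al be := \sum_de F be (cup a) nu de * F al de mu (cup a).
pose G ps si := \sum_rh F si (cup a) rh (cup a) * F ps rh nu mu.
transitivity (G (cup b) (unitr a)); last first.
  rewrite /G (big_single (i := unitl (dual a))) => [|rh].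
    rewrite F_triangle2 ?labE // eqxx mul1r /kerL -/b /a dualK.
    have [->//|ne] := eqVneq (out mu) (in2 nu).
    have [->|/F_labels[_ _ _ [_ + _]]] :=
      eqVneq (F (cup b) (unitl (out mu)) nu mu) 0.
      apply: esym; apply/eqP; apply: contraNT ne.
      by case/kerL_labels=> _ _ ->.
    by rewrite labE => /eqP; rewrite (negbTE ne).
  rewrite mulf_eq0 negb_or => /andP[/F_labels[_ _ _ [+ + _]] _].
  by rewrite !labE => /esym e1 /esym e2; apply: in1_one.
rewrite -(F_projl (H := H) e) => [|al be _]; last exact: pentagonl.
apply: eq_bigr => al _; apply: eq_bigr => be _.
have -> : H al be = F be (cup a) nu (cup (in1 be)) * F al (cup (in1 be)) mu (cup a).
  rewrite /H (big_single (i := cup (in1 be))) // => de.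
  rewrite mulf_eq0 negb_or => /andP[/F_labels[_ _ + [_ _ +]] _].
  by rewrite labE => /esym e1 /esym e2; apply: out_one.
have [e0|/F_labels] := eqVneq (F al be (cup b) (unitr a)) 0.
  rewrite e0 rmorph0 mul0r; apply/eqP/negPn/negP.
  rewrite !mulf_eq0 !negb_or conjC_eq0 => /and3P[nK /rot_labels[e1 _ _]
    /rot_labels[_ _ e2]].
  case/kerK_labels: (nK) => _ e3 _; move/eqP: nK; apply.
  by rewrite /kerK -e0 /b e1 e3 dualK /a e2 dualK.
rewrite !labE => -[e1 _ e2 [e3 _ e4]].
by rewrite /kerK /rot e1 e2 e3 e4.
Qed.

(** The rotation is the part of F with total charge 1, where the second column vertex is forced to
    be a cup. *)
Lemma rot_unitary mu mu' :
  \sum_nu rot mu nu * (rot mu' nu)^* = (mu == mu')%:R.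
Proof.
have [e1|ne] := eqVneq (in1 mu) (in1 mu'); last first.
  rewrite big1 => [|nu _].
    by case: (eqVneq mu mu') ne => [->|]; rewrite ?eqxx.
  apply/eqP; apply: contraNT ne; rewrite mulf_eq0 negb_or conjC_eq0.
  move=> /andP[/rot_labels[_ _ e1] /rot_labels[_ _]]; rewrite e1.
  by move=> /(congr1 (@dual _ B)); rewrite !dualK => /eqP.
have <- : (mu == mu') && (cup (out mu) == cup (out mu')) = (mu == mu').
  by case: eqP => // ->; rewrite eqxx.
rewrite -F_unitary1 ?labE //; apply: eq_bigr => nu _.
rewrite [RHS](big_single (i := cup (in1 mu))) => [|la]; last first.
  rewrite mulf_eq0 negb_or => /andP[/F_labels[_ _ + [_ _ +]] _].
  by rewrite labE => /esym e2 /esym e3; apply: out_one.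
by rewrite /rot e1.
Qed.

End Rigidity.

(** * Gram matrices of leg bending and the cube of the rotation *)

Section RotationMatrices.

Variables (K : numClosedFieldType) (B : ubfc K).
Implicit Types (a b c x : obj B) (v w : vtx B).
Local Notation in1 := (@in1 (obj B) (vtx B) bd).
Local Notation in2 := (@in2 (obj B) (vtx B) bd).
Local Notation out := (@out (obj B) (vtx B) bd).
Local Notation one := (@Defs.one K B).
Local Notation f := (@rigidF K B).

Let MK := lmx (@kerK K B).
Let ML := lmx (@kerL K B).
Definition rotM := lmx (@rot K B).
Local Notation MR := rotM.

Lemma rigidF_neq0 a : f a != 0.
Proof. exact: rigid. Qed.

Lemma qdimE a : qdim a = `|f a|^-1. Proof. by []. Qed.

Lemma qdim_gt0 a : 0 < qdim a.
Proof. by rewrite qdimE invr_gt0 normr_gt0 rigidF_neq0. Qed.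

(** The zig-zags of [a] and of its dual are products of the same two entries of [kerL], with the
    conjugation on opposite factors. *)
Lemma rigidF_dual a : f (dual a) = (f a)^*.
Proof.
have := kerL_rigid (unitr a) (unitr a);
  have := kerL_rigid (cup (dual a)) (cup (dual a)).
rewrite !eqxx !labE !mulr1n => <- <-.
rewrite (big_single (i := unitr a)) => [|v].
  rewrite (big_single (i := cup (dual a))) => [|v].
    by rewrite rmorphM /= conjCK mulrC.
  rewrite mulf_eq0 negb_or conjC_eq0 => /andP[/kerL_labels[+ _ +] _].
  by rewrite !labE => e1 e2; apply: out_one.
rewrite mulf_eq0 negb_or conjC_eq0 => /andP[/kerL_labels[+ + _] _].
by rewrite !labE dualK => e1 e2; apply: in2_one.
Qed.

Lemma qdim_dual a : qdim (dual a) = qdim a.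
Proof. by rewrite !qdimE rigidF_dual norm_conjC. Qed.

Lemma rotM_unitary : MR *m hmx MR = 1%:M.
Proof.
apply: entry_inj => v w; rewrite entry_mul entry1 -rot_unitary.
by apply: eq_bigr => u _; rewrite entry_hmx !entry_lmx.
Qed.

Let rigidK : cmx MK *m MK = dmx (fun v => f (in2 v)).
Proof.
apply: entry_inj => v w; rewrite entry_mul entry_dmx -kerK_rigid.
by apply: eq_bigr => u _; rewrite entry_cmx !entry_lmx.
Qed.

Let rigidL : cmx ML *m ML = dmx (fun v => f (in1 v)).
Proof.
apply: entry_inj => v w; rewrite entry_mul entry_dmx -kerL_rigid.
by apply: eq_bigr => u _; rewrite entry_cmx !entry_lmx.
Qed.

Let ML_rot : ML *m MR = cmx MK.
Proof.
apply: entry_inj => v w; rewrite entry_mul entry_cmx entry_lmx -kerL_rot.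
by apply: eq_bigr => u _; rewrite !entry_lmx.
Qed.

Let ML_tr : MR^T *m cmx MK *m MR = ML^T.
Proof.
apply: entry_inj => v w;
  rewrite -mulmxA entry_mul entry_tr [RHS]entry_lmx -rot_kerK.
apply: eq_bigr => u _; rewrite entry_mul big_distrr; apply: eq_bigr => z _ /=.
by rewrite entry_tr entry_cmx !entry_lmx [LHS]mulrC -mulrA.
Qed.

Definition rigidity_factor v := (f (in1 v) * f (in2 v) / f (out v))^*.
Local Notation e := rigidity_factor.

Lemma rigidity_factor_neq0 v : e v != 0.
Proof. by rewrite /e conjC_eq0 !mulf_neq0 ?invr_eq0 ?rigidF_neq0. Qed.

Lemma norm_rigidity_factor v :
  `|e v| = qdim (out v) / (qdim (in1 v) * qdim (in2 v)).
Proof.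
by rewrite norm_conjC !normrM normfV !qdimE invfM !invrK mulrC.
Qed.

(** With L for [ML], [ML_tr] writes the adjoint of L through the rotation and conj L, and [rigidK]
    writes the adjoint of the rotation through L and conj L. Each product L conj L is then diagonal
    by [rigidL], leaving three conjugated rotations. *)
Let ML_gram : ML *m hmx ML = dmx e *m (cmx MR *m cmx MR *m cmx MR).
Proof.
set D := dmx (fun v => ((f (in2 v))^*)^-1).
have hL : hmx ML = hmx MR *m cmx ML *m cmx MR *m cmx MR.
  by rewrite /hmx -cmx_tr -ML_tr -ML_rot !cmxM cmx_tr !mulmxA.
have Db : D *m dmx (fun v => (f (in2 v))^*) = 1%:M.
  rewrite dmx_mul -dmx1; apply: eq_dmx => v.
  by rewrite mulVf // conjC_eq0 rigidF_neq0.
have hR : hmx MR = D *m (cmx ML *m cmx MR *m ML).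
  have := congr1 (@cmx _ _) rigidK.
  rewrite cmxM cmxK -ML_rot -{1}[MK]cmxK -ML_rot cmxM cmx_dmx => h.
  by rewrite -[LHS]mul1mx -Db -h -!mulmxA rotM_unitary mulmx1.
have cR : cmx MR *m dmx (fun v => (f (in1 v))^*) =
    dmx (fun v => (f (in2 v))^*) *m cmx MR.
  apply: dmx_comm => x y; rewrite entry_cmx entry_lmx conjC_eq0.
  by case/rot_labels=> ->.
have LD : ML *m D = dmx (fun v => ((f (out v))^*)^-1) *m ML.
  by apply: dmx_comm => x y; rewrite entry_lmx => /kerL_labels[_ -> _].
have LcL : ML *m cmx ML = dmx (fun v => (f (in1 v))^*).
  by rewrite -{1}[ML]cmxK -cmxM rigidL cmx_dmx.
rewrite hL hR !mulmxA LD -!(mulmxA _ ML) LcL.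
rewrite -(mulmxA _ (cmx MR) (dmx _)) cR !mulmxA !dmx_mul.
congr (_ *m _ *m _ *m _); apply: eq_dmx => v.
by rewrite /e !rmorphM fmorphV /= [RHS]mulrC mulrA.
Qed.

(** By [ML_gram] this positive operator is a diagonal matrix times a unitary one, so its square is
    diagonal with entries |e|^2; uniqueness of the positive square root finishes. *)
Lemma kerL_gram : ML *m hmx ML = dmx (fun v => `|e v|).
Proof.
apply: psd_sqrt_unique => [v||].
- by rewrite normr_gt0 rigidity_factor_neq0.
- apply: dmx_comm => x y nz.
  apply/eqP; apply: contraNT nz => /negP ne.
  rewrite entry_mul big1 // => z _; rewrite entry_hmx !entry_lmx.
  apply/eqP/negPn/negP; rewrite mulf_eq0 conjC_eq0 negb_or.
  case/andP=> /kerL_labels[h1 h2 h3] /kerL_labels[k1 k2 k3]; apply: ne.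
  rewrite /e -h2 -h3 -k2 -k3; move: h1; rewrite k1 => /(can_inj (@dualK _ _)) ->.
  by rewrite eqxx.
have h : hmx (ML *m hmx ML) = ML *m hmx ML by rewrite hmxM hmxK.
have cu : cmx MR *m hmx (cmx MR) = 1%:M.
  by rewrite /hmx -cmx_tr -/(hmx MR) -cmxM rotM_unitary cmx1.
rewrite -{2}h ML_gram hmxM hmx_dmx !hmxM !mulmxA.
do 3! [rewrite -(mulmxA _ (cmx MR) (hmx (cmx MR))) cu mulmx1].
by rewrite dmx_mul; apply: eq_dmx => v; rewrite normCK.
Qed.

(** Comparing [ML_gram] with [kerL_gram] isolates three rotations: a full turn acts by a phase,
    which need not be 1 without a pivotal normalisation. *)
Lemma rot_cube : MR *m MR *m MR = dmx (fun v => `|e v| / (e v)^*).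
Proof.
apply: (can_inj (@cmxK _ _)); rewrite cmx_dmx !cmxM.
have := ML_gram; rewrite kerL_gram => /(congr1 (mulmx (dmx (fun v => (e v)^-1)))).
rewrite !mulmxA !dmx_mul.
have -> : dmx (fun v => (e v)^-1 * e v) = 1%:M.
  by rewrite -dmx1; apply: eq_dmx => v; rewrite mulVf ?rigidity_factor_neq0.
rewrite mul1mx => <-; apply: eq_dmx => v.
by rewrite rmorphM fmorphV /= conjCK conj_Creal ?normr_real // mulrC.
Qed.

(** [kerK] is the conjugate of [kerL] followed by the unitary rotation, so both have the same Gram
    matrix. *)
Lemma kerK_gram v w : \sum_z kerK v z * (kerK w z)^*
  = (qdim (out v) / (qdim (in1 v) * qdim (in2 v))) *+ (v == w).
Proof.
have cu : MR *m hmx MR = 1%:M by exact: rotM_unitary.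
have h : cmx MK *m hmx (cmx MK) = dmx (fun v => `|e v|).
  rewrite -ML_rot hmxM !mulmxA -(mulmxA ML) cu mulmx1; exact: kerL_gram.
have := congr1 (fun A => entry A w v) h.
rewrite entry_mul entry_dmx.
have -> : `|e w| *+ (w == v) = `|e v| *+ (v == w).
  by rewrite eq_sym; case: eqP => // ->.
rewrite norm_rigidity_factor => <-.
by apply: eq_bigr => z _; rewrite entry_hmx !entry_cmx !entry_lmx conjCK mulrC.
Qed.

Lemma kerL_gram_diag v :
  \sum_z kerL v z * (kerL v z)^* = qdim (out v) / (qdim (in1 v) * qdim (in2 v)).
Proof.
have := congr1 (fun A => entry A v v) kerL_gram.
rewrite entry_mul entry_dmx norm_rigidity_factor eqxx mulr1n => <-.
by apply: eq_bigr => z _; rewrite entry_hmx !entry_lmx.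
Qed.

(** A row of the unitary F has norm 1, and by [kerL_gram_diag] each vertex with incoming labels a
    and b contributes d_c / (d_a d_b) to it. *)
Lemma qdimM a b :
  qdim a * qdim b = \sum_(v | (in1 v == a) && (in2 v == b)) qdim (out v).
Proof.
have e0 : out (cup (dual a)) = in1 (unitl b) by rewrite !labE.
have := F_unitary1 (cup (dual a)) (unitl b) e0; rewrite !eqxx /= mulr1n => h.
have n0 : qdim a * qdim b != 0 by rewrite mulf_neq0 ?gt_eqF ?qdim_gt0.
apply: (mulIf (invr_neq0 n0)); rewrite divff // -h big_distrl [RHS]big_mkcond /=.
apply: eq_bigr => v _.
case: ifP => [/andP[/eqP e1 /eqP e2]|ne].
  by rewrite -e1 -e2 -kerL_gram_diag /kerL; apply: eq_bigr.
rewrite big1 // => w _; apply/eqP/negPn/negP;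
  rewrite mulf_eq0 negb_or => /andP[+ _].
case/F_labels=> _ _ _; rewrite !labE dualK => -[e1 e2 _].
by rewrite -e1 -e2 !eqxx in ne.
Qed.

End RotationMatrices.

(** * Frobenius reciprocity and the partial trace of F *)

Section QuantumDimensions.

Variables (K : numClosedFieldType) (B : ubfc K).
Implicit Types (a b c x : obj B) (la be ga ps si rh v w : vtx B).
Local Notation in1 := (@in1 (obj B) (vtx B) bd).
Local Notation in2 := (@in2 (obj B) (vtx B) bd).
Local Notation out := (@out (obj B) (vtx B) bd).
Local Notation one := (@Defs.one K B).
Local Notation F := (@Fsym K B).

(** Frobenius reciprocity, the multiplicity of c in ab being that of b in (dual a)c: the zig-zag
    scalar is expanded by [kerL_rigid] on either side and the two sums over vertices are
    exchanged. *)
Lemma sum_dual_reindex a (Phi : obj B -> obj B -> K) :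
  \sum_(v | in1 v == a) Phi (in2 v) (out v)
  = \sum_(v | in1 v == dual a) Phi (out v) (in2 v).
Proof.
apply: (mulIf (rigidF_neq0 a));
  rewrite !big_distrl /= [LHS]big_mkcond [RHS]big_mkcond /=.
transitivity (\sum_v \sum_w
  if in1 v == a then Phi (in2 v) (out v) * ((kerL v w)^* * kerL w v) else 0).
  apply: eq_bigr => v _; case: ifP => [/eqP<-|_]; last by rewrite big1.
  by rewrite -big_distrr kerL_rigid eqxx.
rewrite exchange_big; apply: eq_bigr => w _ /=; case: ifP => [/eqP e|ne].
  rewrite -[a in rigidF a]dualK rigidF_dual -e.
  have -> : rigidF (in1 w) = rigidF (in1 w) *+ (w == w) by rewrite eqxx.
  rewrite -kerL_rigid rmorph_sum big_distrr; apply: eq_bigr => v _ /=.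
  rewrite rmorphM /= conjCK.
  have [->|/kerL_labels[e1 e2 e3]] := eqVneq (kerL w v) 0.
    by rewrite !(mulr0, mul0r) if_same.
  by rewrite e1 e dualK eqxx e2 e3 [kerL w v * _]mulrC.
rewrite big1 // => v _; case: ifP => [/eqP e|//].
have [->|/kerL_labels[e1 e2 e3]] := eqVneq (kerL v w) 0.
  by rewrite rmorph0 mul0r mulr0.
by rewrite e1 e eqxx in ne.
Qed.

Lemma kerK_exists v : exists w, kerK v w != 0.
Proof.
have := kerK_rigid v v; rewrite eqxx => h.
apply/existsP; apply: contraT; rewrite negb_exists => /forallP h0.
have /eqP := rigidF_neq0 (in2 v); case; rewrite -[LHS]h big1 // => w _.
by have := h0 w; rewrite negbK => /eqP ->; rewrite rmorph0 mul0r.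
Qed.

Lemma cup_one : cup one = unitr one.
Proof.
rewrite -unitl1; apply: in1_one_out; by rewrite labE.
Qed.

Lemma dual_one : dual one = one.
Proof. by rewrite -(in2_cup one) cup_one labE. Qed.

Lemma qdim_one : qdim one = 1.
Proof.
rewrite qdimE /rigidF dual_one cup_one unitl1.
have -> : F (unitr one) (unitr one) (unitr one) (unitr one) = 1.
  by rewrite -{3}unitl1 F_triangle2 ?labE // eqxx.
by rewrite normr1 invr1.
Qed.

Lemma qdim_ge1 a : 1 <= qdim a.
Proof.
rewrite -(@expr_ge1 _ 2) ?(ltW (qdim_gt0 _)) // expr2 -{2}(qdim_dual a) qdimM.
rewrite (bigD1 (cup a)) ?labE ?eqxx //= qdim_one lerDl.
by apply: sumr_ge0 => v _; rewrite ltW ?qdim_gt0.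
Qed.

(** Bending a leg commutes with reassociation; this is the pentagon with one inner pair fused to
    1. *)
Lemma kerK_F la ps si ga :
  \sum_be (F la be ps si)^* * kerK be ga = \sum_rh kerK ps rh * F si ga rh la.
Proof.
have [e|ne] := eqVneq (out ps) (in2 si); last first.
  rewrite !big1 // => [rh _|be _]; apply/eqP; apply: contraNT ne;
    rewrite mulf_eq0 negb_or.
    by case/andP=> /kerK_labels[<- _ _] /F_labels[_ _ _ [-> _ _]].
  by rewrite conjC_eq0 => /andP[/F_labels[_ -> _ _] _].
pose G ps si := \sum_rh F si ga rh la * kerK ps rh.
transitivity (G ps si); last by apply: eq_bigr => rh _; rewrite mulrC.
rewrite -(F_projl (H := fun al be => kerK be ga *+ (al == la)) e) => [|al be].
  rewrite [RHS](big_single (i := la)) => [|al].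
    by apply: eq_bigr => be _; rewrite eqxx.
  by apply: contraNeq => /negbTE ->; rewrite big1 // => be _; rewrite mulr0.
move=> /F_labels[e1 _ _ [e2 e3 _]].
rewrite pentagon_cup //; apply: eq_bigr => ps' _; apply: eq_bigr => si' _.
have [->|/F_labels[_ _ _ [e4 e5 _]]] := eqVneq (F al be ps' si') 0.
  by rewrite !mul0r.
by congr (_ * _); apply: eq_bigr => rh _; rewrite /kerK e4 e5.
Qed.

(* Both sides come from [kerK_F] multiplied by its conjugate and summed over  *)
(* [ga] and [si].                                                             *)
Lemma F_partial_trace la la' ps ps' :
  \sum_be \sum_si qdim (out be) * (F la be ps si * (F la' be ps' si)^*)
  = (qdim (out la) * qdim (out ps) / qdim (in1 ps))
      *+ [&& la == la', ps == ps' & in2 la == in1 ps].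
Proof.
have [e|ne] := eqVneq (in2 la) (in1 ps); last first.
  rewrite !andbF mulr0n big1 // => be _; rewrite big1 // => si _.
  apply/eqP; apply: contraNT ne; rewrite !mulf_eq0 !negb_or => /and3P[_ + _].
  by case/F_labels=> _ _ _ [-> _ _].
pose A la ps si ga := \sum_be (F la be ps si)^* * kerK be ga.
pose T := \sum_si \sum_ga (A la ps si ga)^* * A la' ps' si ga.
have T1 : T = \sum_be \sum_si
    (qdim (out la) * qdim (in2 ps))^-1 *
    (qdim (out be) * (F la be ps si * (F la' be ps' si)^*)).
  rewrite exchange_big /T; apply: eq_bigr => si _ /=.
  transitivity (\sum_ga \sum_be \sum_be' (F la be ps si * (F la' be' ps' si)^*)
     * (kerK be' ga * (kerK be ga)^*)).
    apply: eq_bigr => ga _; rewrite /A rmorph_sum big_distrl;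
      apply: eq_bigr => be _ /=.
    rewrite big_distrr; apply: eq_bigr => be' _ /=.
    rewrite rmorphM /= conjCK mulrACA; congr (_ * _); exact: mulrC.
  rewrite exchange_big; apply: eq_bigr => be _ /=.
  rewrite exchange_big (big_single (i := be)) => [|be'].
    rewrite -big_distrr kerK_gram eqxx mulr1n /=.
    have [->|/F_labels[<- _ _ [_ -> _]]] := eqVneq (F la be ps si) 0.
      by rewrite !(mul0r, mulr0).
    by rewrite mulrC (mulrC (qdim _)) -mulrA.
  apply: contraNeq => ne.
  by rewrite -big_distrr kerK_gram (negbTE ne) mulr0n /= mulr0.
have T2 : T = (qdim (out ps) / (qdim (in1 ps) * qdim (in2 ps)))
    *+ ((la == la') && (ps == ps')).
  transitivity (\sum_rh \sum_rh' (kerK ps' rh' * (kerK ps rh)^*) *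
     (\sum_si \sum_ga (F si ga rh la)^* * F si ga rh' la')).
    transitivity (\sum_si \sum_ga \sum_rh \sum_rh' (kerK ps' rh' * (kerK ps rh)^*)
       * ((F si ga rh la)^* * F si ga rh' la')).
      apply: eq_bigr => si _; apply: eq_bigr => ga _.
      rewrite /A !kerK_F rmorph_sum big_distrl; apply: eq_bigr => rh _ /=.
      rewrite big_distrr; apply: eq_bigr => rh' _ /=.
      rewrite rmorphM /= mulrACA; congr (_ * _); exact: mulrC.
    under eq_bigr => si _ do rewrite exchange_big /=.
    rewrite exchange_big; apply: eq_bigr => rh _ /=.
    under eq_bigr => si _ do rewrite exchange_big /=.
    rewrite exchange_big; apply: eq_bigr => rh' _ /=.
    by rewrite big_distrr; apply: eq_bigr => si _ /=; rewrite big_distrr.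
  transitivity (\sum_rh kerK ps' rh * (kerK ps rh)^* *+ (la == la')).
    apply: eq_bigr => rh _.
    have [h0|/kerK_labels[_ _ e3]] := eqVneq (kerK ps rh) 0.
      rewrite h0 rmorph0 mulr0 mul0rn big1 // => rh' _.
      by rewrite mulr0 mul0r.
    have e' : out rh = in2 la by rewrite e3 e.
    rewrite (big_single (i := rh)) => [|rh'].
      by rewrite F_unitary2 // eqxx /= mulr_natr.
    by apply: contraNeq => ne; rewrite F_unitary2 // (eq_sym rh) (negbTE ne) mulr0.
  rewrite sumrMnl kerK_gram (eq_sym ps').
  have [->|_] := eqVneq ps ps'; first by rewrite mulr1n andbT.
  by rewrite mulr0n mul0rn andbF.
have n0 : qdim (out la) * qdim (in2 ps) != 0.
  by rewrite mulf_neq0 ?gt_eqF ?qdim_gt0.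
apply: (mulfI (invr_neq0 n0)); rewrite big_distrr /=.
under eq_bigr => be _ do rewrite big_distrr /=.
rewrite -T1 T2 andbT mulrnAr; congr (_ *+ _).
by field; rewrite !gt_eqF ?qdim_gt0.
Qed.

End QuantumDimensions.

(** * Braiding and the Verlinde formula *)

Lemma sum_pair (R : nmodType) (I J : finType) (G : I * J -> R) :
  \sum_p G p = \sum_i \sum_j G (i, j).
Proof. by rewrite pair_bigA; apply: eq_bigr => -[]. Qed.

Section Braiding.

Variables (K : numClosedFieldType) (B : ubfc K).
Implicit Types (a b c x : obj B) (al be ga mu nu la ps si v w : vtx B).
Local Notation V := (vtx B).
Local Notation in1 := (@in1 (obj B) (vtx B) bd).
Local Notation in2 := (@in2 (obj B) (vtx B) bd).
Local Notation out := (@out (obj B) (vtx B) bd).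
Local Notation one := (@Defs.one K B).
Local Notation F := (@Fsym K B).
Local Notation R := (@Rsym K B).

Lemma R_labels mu nu : R mu nu != 0 ->
  [/\ in1 mu = in2 nu, in2 mu = in1 nu & out mu = out nu].
Proof. by move=> /R_supp; rewrite /Defs.in1 /Defs.in2 /Defs.out => ->. Qed.

Lemma R_exists mu : exists nu, R mu nu != 0.
Proof.
have := R_unitary1 mu mu; rewrite eqxx => h.
apply/existsP; apply: contraT; rewrite negb_exists => /forallP h0.
have /eqP := oner_neq0 K; case; rewrite -[LHS]h big1 // => w _.
by have := h0 w; rewrite negbK => /eqP ->; rewrite mul0r.
Qed.

(** The S-matrix without its factor 1/D, so that no square roots enter the Verlinde formula. *)
Definition strace a b : K :=
  \sum_(v | (in1 v == a) && (in2 v == b)) qdim (out v) * dbraid v v.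

Lemma strace_sym a b : strace a b = strace b a.
Proof.
rewrite /strace [LHS]big_mkcond [RHS]big_mkcond /=.
transitivity (\sum_v \sum_u
  if (in1 v == a) && (in2 v == b) then qdim (out v) * (R v u * R u v) else 0).
  apply: eq_bigr => v _; case: ifP => _; last by rewrite big1.
  by rewrite -big_distrr.
rewrite exchange_big; apply: eq_bigr => u _ /=.
transitivity (\sum_v
  if (in1 u == b) && (in2 u == a) then qdim (out u) * (R u v * R v u) else 0).
  apply: eq_bigr => v _.
  have [->|/R_labels[-> -> ->]] := eqVneq (R v u) 0.
    by rewrite !(mul0r, mulr0) !if_same.
  by rewrite andbC [R u v * _]mulrC.
case: ifP => _; last by rewrite big1.
by rewrite -big_distrr.
Qed.

(** Pairs of vertices are basis vectors of three-strand spaces in either bracketing; rows use the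
    left one, columns the right one. *)
Let FM : 'M[K]_#|{: V * V}| := lmx (fun p q => F p.1 p.2 q.1 q.2).
Let fst_mx (S : V -> V -> K) : 'M[K]_#|{: V * V}| :=
  lmx (fun p q => S p.1 q.1 *+ (p.2 == q.2)).
Let snd_mx (S : V -> V -> K) : 'M[K]_#|{: V * V}| :=
  lmx (fun p q => S p.2 q.2 *+ (p.1 == q.1)).
Let Rinv mu nu := (R nu mu)^*.

Let entry_mul_fst S A p q :
  entry (A *m fst_mx S) p q = \sum_w entry A p (w, q.2) * S w q.1.
Proof.
rewrite entry_mul sum_pair /=.
apply: eq_bigr => w _; rewrite (big_single (i := q.2)) => [|v].
  by rewrite entry_lmx /= eqxx.
rewrite entry_lmx /= mulf_eq0 negb_or => /andP[_].
by case: (eqVneq v q.2) => // _; rewrite eqxx.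
Qed.

Let entry_fst_mul S A p q :
  entry (fst_mx S *m A) p q = \sum_w S p.1 w * entry A (w, p.2) q.
Proof.
rewrite entry_mul sum_pair /=.
apply: eq_bigr => w _; rewrite (big_single (i := p.2)) => [|v].
  by rewrite entry_lmx /= eqxx.
rewrite entry_lmx /= mulf_eq0 negb_or => /andP[+ _].
by rewrite (eq_sym _ v); case: (eqVneq v p.2) => // _; rewrite eqxx.
Qed.

Let entry_snd_mul S A p q :
  entry (snd_mx S *m A) p q = \sum_w S p.2 w * entry A (p.1, w) q.
Proof.
rewrite entry_mul sum_pair /=.
rewrite (big_single (i := p.1)) => [|v].
  by apply: eq_bigr => w _; rewrite entry_lmx /= eqxx.
apply: contraNeq => ne; rewrite big1 // => w _.
by rewrite entry_lmx /= eq_sym (negbTE ne) mulr0n mul0r.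
Qed.

Let fst_mx_mul S S' : fst_mx S *m fst_mx S' =
  fst_mx (fun v w => \sum_u S v u * S' u w).
Proof.
apply: entry_inj => p q; rewrite entry_fst_mul entry_lmx -sumrMnl.
by apply: eq_bigr => w _; rewrite entry_lmx mulrnAr.
Qed.

Let snd_mx_mul S S' : snd_mx S *m snd_mx S' =
  snd_mx (fun v w => \sum_u S v u * S' u w).
Proof.
apply: entry_inj => p q; rewrite entry_snd_mul entry_lmx -sumrMnl.
by apply: eq_bigr => w _; rewrite entry_lmx mulrnAr.
Qed.

Let fst_mx_hmx S : hmx (fst_mx S) = fst_mx (fun v w => (S w v)^*).
Proof.
apply: entry_inj => p q; rewrite entry_hmx !entry_lmx eq_sym.
by case: eqP => _; rewrite ?rmorph0.
Qed.

Let snd_mx_hmx S : hmx (snd_mx S) = snd_mx (fun v w => (S w v)^*).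
Proof.
apply: entry_inj => p q; rewrite entry_hmx !entry_lmx eq_sym.
by case: eqP => _; rewrite ?rmorph0.
Qed.

Let hexagonM S :
  (forall al be mu nu,
    \sum_la \sum_ga S al la * F la be ga nu * S ga mu =
    \sum_de \sum_si \sum_ps F al be de si * S si ps * F de ps mu nu) ->
  fst_mx S *m FM *m fst_mx S = FM *m snd_mx S *m FM.
Proof.
move=> hex; apply: entry_inj => -[al be] [mu nu].
rewrite entry_mul_fst -mulmxA entry_mul.
rewrite sum_pair /=.
transitivity (\sum_la \sum_ga S al la * F la be ga nu * S ga mu).
  rewrite exchange_big; apply: eq_bigr => ga _ /=.
  rewrite entry_fst_mul big_distrl; apply: eq_bigr => la _.
  by rewrite entry_lmx.
rewrite hex; apply: eq_bigr => de _; apply: eq_bigr => si _.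
rewrite entry_snd_mul big_distrr; apply: eq_bigr => ps _ /=.
by rewrite !entry_lmx /= -mulrA.
Qed.

Let FM_unitary1 : FM *m hmx FM = dmx (fun p => (out p.1 == in1 p.2)%:R).
Proof.
apply: entry_inj => -[al be] [al' be']; rewrite entry_mul entry_dmx.
rewrite sum_pair /=.
have [e|ne] := eqVneq (out al) (in1 be).
  rewrite -[RHS]F_unitary1 //; apply: eq_bigr => mu _; apply: eq_bigr => nu _.
  by rewrite entry_hmx !entry_lmx.
rewrite mul0rn big1 // => mu _; rewrite big1 // => nu _; rewrite !entry_lmx /=.
have [->|/F_labels[e _ _ _]] := eqVneq (F al be mu nu) 0; first by rewrite mul0r.
by rewrite e eqxx in ne.
Qed.

Let FM_unitary2 : hmx FM *m FM = dmx (fun q => (out q.1 == in2 q.2)%:R).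
Proof.
apply: entry_inj => -[mu nu] [mu' nu']; rewrite entry_mul entry_dmx.
rewrite sum_pair /=.
have [e|ne] := eqVneq (out mu) (in2 nu).
  rewrite -[RHS]F_unitary2 //; apply: eq_bigr => al _; apply: eq_bigr => be _.
  by rewrite entry_hmx !entry_lmx.
rewrite mul0rn big1 // => al _; rewrite big1 // => be _;
  rewrite entry_hmx !entry_lmx /=.
have [->|/F_labels[_ e _ _]] := eqVneq (F al be mu nu) 0;
  first by rewrite rmorph0 mul0r.
by rewrite e eqxx in ne.
Qed.

(** Taking a strand round two others one after the other equals taking it round their fusion
    product; the hexagon is multiplied by the adjoint of the inverse hexagon. *)
Let monodromy :
  fst_mx R *m FM *m fst_mx (@dbraid K B) *m hmx FM *m fst_mx R
  = FM *m snd_mx (@dbraid K B) *m hmx FM.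
Proof.
have h1 := hexagonM (@hexagon K B).
have h2 : fst_mx R *m hmx FM *m fst_mx R = hmx FM *m snd_mx R *m hmx FM.
  have := congr1 (@hmx _ _) (hexagonM (S := Rinv) (@hexagon_inv K B)).
  rewrite !hmxM fst_mx_hmx snd_mx_hmx !mulmxA.
  suff E S : S =2 R -> fst_mx S = fst_mx R /\ snd_mx S = snd_mx R.
    have RK : (fun v w => (Rinv w v)^*) =2 R by move=> v w; rewrite /Rinv conjCK.
    by have [-> ->] := E _ RK.
  by move=> ES; split; apply: entry_inj => p q; rewrite !entry_lmx ES.
have -> : fst_mx (@dbraid K B) = fst_mx R *m fst_mx R by rewrite fst_mx_mul.
rewrite !mulmxA h1 -!mulmxA (mulmxA (fst_mx R)) h2.
rewrite -!mulmxA; congr (_ *m _).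
rewrite (mulmxA FM) FM_unitary1 !mulmxA.
have comm : snd_mx R *m dmx (fun q => (out q.1 == in2 q.2)%:R)
    = dmx (fun p => (out p.1 == in1 p.2)%:R) *m snd_mx R.
  apply: dmx_comm => p q; rewrite entry_lmx mulrb.
  by case: (eqVneq p.1 q.1) => [->|_]; rewrite ?eqxx // => /R_labels[-> _ _].
rewrite -(mulmxA (snd_mx R)) -comm mulmxA snd_mx_mul -mulmxA; congr (_ *m _).
apply: entry_inj => q p; rewrite entry_dmul entry_hmx entry_lmx.
have [->|/F_labels[_ -> _ _]] := eqVneq (F p.1 p.2 q.1 q.2) 0.
  by rewrite rmorph0 mulr0.
by rewrite eqxx mul1r.
Qed.

(* Trace of [monodromy] weighted by the quantum dimension of the total charge. *)
Lemma verlinde a b c :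
  strace a c * strace c b
  = qdim c * \sum_(v | (in1 v == a) && (in2 v == b)) strace c (out v).
Proof.
(* The same weight, the dimension of the total charge, for the strand orders c,a,b and a,c,b and for
   the other bracketing. R and F intertwine these weights, so the trace is cyclic. *)
pose W p : K := qdim (out p.2) *+ [&& in1 p.1 == c, in2 p.1 == a & in2 p.2 == b].
pose W' p : K := qdim (out p.2) *+ [&& in1 p.1 == a, in2 p.1 == c & in2 p.2 == b].
pose W2 q : K := qdim (out q.2) *+ [&& in1 q.2 == c, in1 q.1 == a & in2 q.1 == b].
have WR : fst_mx R *m dmx W' = dmx W *m fst_mx R.
  apply: dmx_comm => p q; rewrite entry_lmx mulrb /W /W'.
  case: (eqVneq p.2 q.2) => [->|_]; rewrite ?eqxx // => /R_labels[-> -> _].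
  by rewrite andbCA.
have WF : FM *m dmx W2 = dmx W *m FM.
  apply: dmx_comm => p q; rewrite entry_lmx /W /W2.
  by case/F_labels=> _ _ -> [-> -> ->].
have := congr1 (fun A => \tr (dmx W *m A)) monodromy.
rewrite /= !mulmxA -WR -WF mxtrace_mulC -(mulmxA FM) -(mulmxA FM) -!mulmxA.
rewrite (mxtrace_mulC FM) -!mulmxA FM_unitary2.
rewrite (mulmxA (fst_mx R) (fst_mx R)) fst_mx_mul.
have -> : \tr (dmx W2 *m (snd_mx (@dbraid K B) *m dmx (fun q => (out q.1 == in2
  q.2)%:R)))
    = \sum_(v | (in1 v == a) && (in2 v == b)) strace c (out v).
  rewrite entry_trace sum_pair [RHS]big_mkcond; apply: eq_bigr => de _ /=.
  under eq_bigr => si _ do rewrite entry_dmul entry_muld entry_lmx /= eqxx mulr1n.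
  case: ifP => [/andP[/eqP e1 /eqP e2]|ne].
    rewrite /strace [RHS]big_mkcond; apply: eq_bigr => si _.
    rewrite /W2 /= e1 e2 !eqxx !andbT (eq_sym (out de)).
    by do 2! case: eqP => _; rewrite ?(mulr1n, mulr0n, mul0r, mulr0, mulr1).
  by rewrite big1 // => si _; rewrite /W2 /= ne andbF mulr0n mul0r.
move=> <-; rewrite entry_trace sum_pair.
transitivity (qdim c * \sum_al \sum_al' \sum_ga \sum_ga'
   dbraid al al' * dbraid ga ga' * \sum_be \sum_nu (W' (al', be) * 
     (F al' be ga nu * (F al be ga' nu)^*))); last first.
  congr (_ * _); apply: esym.
  transitivity (\sum_al \sum_be \sum_al' \sum_ga \sum_nu \sum_ga'
     dbraid al al' * dbraid ga ga' *
      (W' (al', be) * (F al' be ga nu * (F al be ga' nu)^*))).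
    apply: eq_bigr => al _; apply: eq_bigr => be _.
    rewrite entry_fst_mul; apply: eq_bigr => al' _ /=.
    rewrite entry_dmul entry_mul sum_pair !big_distrr; apply: eq_bigr => ga _ /=.
    rewrite !big_distrr; apply: eq_bigr => nu _ /=.
    rewrite entry_fst_mul !big_distrr; apply: eq_bigr => ga' _ /=.
    rewrite entry_hmx !entry_lmx /= -/(dbraid al al'); ring.
  apply: eq_bigr => al _; rewrite exchange_big; apply: eq_bigr => al' _ /=.
  rewrite exchange_big; apply: eq_bigr => ga _ /=.
  under eq_bigr => be _ do rewrite exchange_big /=.
  rewrite exchange_big; apply: eq_bigr => ga' _ /=.
  rewrite [RHS]big_distrr; apply: eq_bigr => be _ /=.
  by rewrite [RHS]big_distrr.
transitivity (qdim c * \sum_al \sum_ga dbraid al al * dbraid ga ga *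
   ((qdim (out al) * qdim (out ga) / qdim c) *+
     [&& in1 al == a, in2 al == c, in1 ga == c & in2 ga == b])).
  rewrite /strace big_distrlr [RHS]big_distrr [LHS]big_mkcond;
    apply: eq_bigr => al _ /=.
  case: ifP => [/andP[-> ->]|ne].
    rewrite [LHS]big_mkcond [RHS]big_distrr; apply: eq_bigr => ga _ /=.
    case: ifP => _; rewrite ?mulr0n ?mulr0 // mulr1n.
    by field; rewrite gt_eqF ?qdim_gt0.
  rewrite big1 ?mulr0 // => ga _.
  by rewrite andbA ne mulr0n mulr0.
(* The partial trace over the total charge forces both double braids to be diagonal, so the trace
   factors into two. *)
have PT al' al ga ga' :
    \sum_be \sum_nu W' (al', be) * (F al' be ga nu * (F al be ga' nu)^*)
    = (qdim (out al') * qdim (out ga) / qdim c) *+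
     [&& al' == al, ga == ga', in1 al' == a, in2 al' == c,
       in1 ga == c & in2 ga == b].
  transitivity ((\sum_be \sum_nu qdim (out be) * (F al' be ga nu *
    (F al be ga' nu)^*))
     *+ [&& in1 al' == a, in2 al' == c & in2 ga == b]).
    rewrite -sumrMnl; apply: eq_bigr => be _; rewrite -sumrMnl;
      apply: eq_bigr => nu _.
    have [->|/F_labels[_ _ _ [_ <- _]]] := eqVneq (F al' be ga nu) 0.
      by rewrite !(mul0r, mulr0) mul0rn.
    by rewrite /W' /= mulrnAl.
  rewrite F_partial_trace.
  case: (al' == al); rewrite /= ?mul0rn //; case: (ga == ga');
    rewrite /= ?mul0rn //.
  case: (in1 al' == a); rewrite /= ?mulr0n //.
  case: (eqVneq (in2 al') c) => [->|]; rewrite /= ?mulr0n //.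
  rewrite (eq_sym c); case: (eqVneq (in1 ga) c) => [->|]; rewrite /= ?mul0rn //.
congr (_ * _); apply: eq_bigr => al _; apply: esym.
transitivity (\sum_al' \sum_ga \sum_ga' dbraid al al' * dbraid ga ga' *
    ((qdim (out al') * qdim (out ga) / qdim c) *+ [&& al' == al, ga == ga',
       in1 al' == a, in2 al' == c, in1 ga == c & in2 ga == b])).
  by apply: eq_bigr => al' _; apply: eq_bigr => ga _; apply: eq_bigr => ga' _;
     rewrite PT.
rewrite (big_single (i := al)) => [|al'].
  apply: eq_bigr => ga _; rewrite (big_single (i := ga)) => [|ga'].
    by rewrite !eqxx.
  by apply: contraNeq => ne; rewrite (eq_sym ga) (negbTE ne) andbF mulr0n mulr0.
apply: contraNeq => ne; rewrite big1 // => ga _; rewrite big1 // => ga' _.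
by rewrite (negbTE ne) mulr0n mulr0.
Qed.

End Braiding.

(** * Invertible objects and fermions *)

Section Invertible.

Variables (K : numClosedFieldType) (B : ubfc K).
Implicit Types (a b c x : obj B) (al be ga mu nu la ps si v w : vtx B).
Local Notation in1 := (@in1 (obj B) (vtx B) bd).
Local Notation in2 := (@in2 (obj B) (vtx B) bd).
Local Notation out := (@out (obj B) (vtx B) bd).
Local Notation one := (@Defs.one K B).
Local Notation F := (@Fsym K B).
Local Notation R := (@Rsym K B).

(** Abstracting the braiding allows the same argument for R and for its inverse. *)
Definition braiding_labels (S : vtx B -> vtx B -> K) := forall mu nu,
  S mu nu != 0 ->
  [/\ in1 mu = in2 nu, in2 mu = in1 nu & out mu = out nu].
Definition hexagon_eq (S : vtx B -> vtx B -> K) := forall al be mu nu,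
  \sum_la \sum_ga S al la * F la be ga nu * S ga mu =
  \sum_de \sum_si \sum_ps F al be de si * S si ps * F de ps mu nu.

Lemma braiding_labels_R : braiding_labels R.
Proof. exact: R_labels. Qed.

Lemma braiding_labels_Rinv : braiding_labels (fun mu nu => (R nu mu)^*).
Proof. by move=> mu nu; rewrite conjC_eq0 => /R_labels[-> -> ->]. Qed.

(** The hexagon for [c] and two trivial strands. *)
Lemma hexagon_unit S c : braiding_labels S -> hexagon_eq S ->
  S (unitr c) (unitl c) ^+ 2 = S (unitr c) (unitl c).
Proof.
move=> lS /(_ (unitr c) (unitr c) (unitl c) (unitl c)).
rewrite (big_single (i := unitl c)) => [|la]; last first.
  apply: contraNeq => ne; rewrite big1 // => ga _.
  have [->|/lS] := eqVneq (S (unitr c) la) 0; first by rewrite !mul0r.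
  by rewrite !labE => -[_ /esym e1 /esym e2];
    rewrite (in1_one_out e1 e2) eqxx in ne.
rewrite (big_single (i := unitr c)) => [|ga]; last first.
  rewrite mulf_eq0 negb_or => /andP[_ /lS]; rewrite !labE => -[e1 e2 _].
  exact: in2_one.
rewrite F_triangle1 ?labE // eqxx mulr1 -expr2 => ->.
rewrite (big_single (i := unitl one)) => [|de]; last first.
  apply: contraNeq => ne; rewrite big1 // => si _; rewrite big1 // => ps _.
  have [->|/F_labels] := eqVneq (F (unitr c) (unitr c) de si) 0.
    by rewrite !mul0r.
  by rewrite !labE => -[_ _ _ [/esym e1 /esym e2 _]];
    rewrite (in1_one e1 e2) eqxx in ne.
rewrite (big_single (i := unitr c)) => [|si]; last first.
  apply: contraNeq => ne; rewrite big1 // => ps _.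
  have [->|/F_labels] := eqVneq (F (unitr c) (unitr c) (unitl one) si) 0.
    by rewrite !mul0r.
  by rewrite !labE => -[_ /esym e1 /esym e2 _]; rewrite (in2_one e1 e2) eqxx in ne.
rewrite (big_single (i := unitl c)) => [|ps]; last first.
  rewrite !mulf_eq0 !negb_or -andbA => /and3P[_ /lS + _].
  by rewrite !labE => -[_ /esym e1 /esym e2]; apply: in1_one_out.
by rewrite F_triangle2 ?labE // eqxx F_triangle1 ?labE // eqxx mul1r mulr1.
Qed.

Lemma R_unitr c : R (unitr c) (unitl c) = 1.
Proof.
have nz : R (unitr c) (unitl c) != 0.
  have [w nz] := R_exists (unitr c); case/R_labels: (nz);
    rewrite !labE => _ /esym e1 /esym e2.
  by rewrite -(in1_one_out e1 e2).
apply: (mulfI nz); rewrite mulr1 -expr2.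
exact: (hexagon_unit c braiding_labels_R (@hexagon K B)).
Qed.

Lemma R_unitl c : R (unitl c) (unitr c) = 1.
Proof.
have nz : R (unitl c) (unitr c) != 0.
  have [w nz] := R_exists (unitl c); case/R_labels: (nz);
    rewrite !labE => /esym e1 _ /esym e2.
  by rewrite -(in2_one_out e1 e2).
apply: (can_inj (@conjCK K)); rewrite rmorph1.
have nz' : (R (unitl c) (unitr c))^* != 0 by rewrite conjC_eq0.
apply: (mulfI nz'); rewrite mulr1 -expr2.
exact: (hexagon_unit c braiding_labels_Rinv (@hexagon_inv K B)).
Qed.

Lemma dbraid_unitr a : dbraid (unitr a) (unitr a) = 1.
Proof.
rewrite /dbraid (big_single (i := unitl a)) ?R_unitr ?R_unitl ?mulr1 // => u.
rewrite mulf_eq0 negb_or => /andP[/R_labels + _].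
by rewrite !labE => -[_ /esym e1 /esym e2]; apply: in1_one_out.
Qed.

Lemma strace_one a : strace a one = qdim a.
Proof.
rewrite /strace (big_pred1 (unitr a)) ?dbraid_unitr ?labE ?mulr1 // => v /=.
apply/andP/eqP => [[/eqP e1 /eqP e2]|->]; last by rewrite !labE.
exact: in2_one.
Qed.

Lemma mutual_one a : mutual a one = 1.
Proof.
rewrite /mutual (big_pred1 (unitr a)) ?dbraid_unitr // => v /=.
rewrite /src1 /src2; apply/andP/eqP => [[/eqP e1 /eqP e2]|->];
  last by rewrite !labE.
exact: in2_one.
Qed.

Section InvertibleObject.

Variables (x : obj B) (hx : qdim x = 1).

(** Bending the [x] leg shows that [in1 v] occurs in the product of [out v] with [dual x], which has
    dimension d_{out v}. *)
Lemma qdim_out_ge v : in2 v = x -> qdim (in1 v) <= qdim (out v).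
Proof.
move=> e; have [w /kerK_labels[e1 e2 e3]] := kerK_exists v.
have -> : qdim (out v) = qdim (out v) * qdim (dual x) by rewrite qdim_dual hx mulr1.
rewrite qdimM (bigD1 w) /= ?e1 ?e2 ?e ?eqxx // e3 lerDl.
by apply: sumr_ge0 => u _; rewrite ltW ?qdim_gt0.
Qed.

Lemma invertible_vertex a : exists v, in1 v = a /\ in2 v = x.
Proof.
have := qdimM a x; rewrite hx mulr1 => h.
have [v /andP[/eqP e1 /eqP e2]|no] := pickP (fun v => (in1 v == a) && (in2 v == x)).
  by exists v.
by move: h; rewrite big_pred0 // => /eqP; rewrite gt_eqF ?qdim_gt0.
Qed.

(** Every channel of a x has dimension at least d_a, while all channels together have dimension d_a;
    so there is room for one. *)
Lemma invertible_uniq v w : in1 v = in1 w -> in2 v = x -> in2 w = x -> v = w.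
Proof.
move=> e1 e2 e3; apply/eqP; apply: contraT => ne.
have := qdimM (in1 v) x; rewrite hx mulr1 (bigD1 v) /= ?eqxx ?e2 ?eqxx //.
rewrite (bigD1 w) /= ?e1 ?e3 ?eqxx //=; last by rewrite eq_sym.
move=> h; have := lt_le_trans _ (qdim_out_ge e2); rewrite [X in qdim X]e1.
move=> /(_ (qdim (out v))); rewrite ltxx => -> //.
rewrite [X in _ < X]h ltrDl ltr_wpDr ?qdim_gt0 //.
by apply: sumr_ge0 => u _; rewrite ltW ?qdim_gt0.
Qed.

Lemma invertible_uniq' v w : in2 v = in2 w -> in1 v = x -> in1 w = x -> v = w.
Proof.
move=> e1 e2 e3; have [v1 nv] := R_exists v; have [w1 nw] := R_exists w.
have [k1 k2 _] := R_labels nv; have [l1 l2 _] := R_labels nw.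
have e : w1 = v1 by apply: invertible_uniq; congruence.
apply/eqP; apply: contraT => ne; have := R_unitary1 v w.
rewrite (negbTE ne) (big_single (i := v1)) => [|u].
  by move/eqP; rewrite mulf_eq0 conjC_eq0 (negbTE nv) -e (negbTE nw).
rewrite mulf_eq0 negb_or => /andP[/R_labels[k3 k4 _] _].
by apply: invertible_uniq; congruence.
Qed.

Lemma qdim_out v : in2 v = x -> qdim (out v) = qdim (in1 v).
Proof.
move=> e; have := qdimM (in1 v) x; rewrite hx mulr1 (big_pred1 v) // => w /=.
apply/andP/eqP => [[/eqP e1 /eqP e2]|->]; last by rewrite e eqxx.
exact: invertible_uniq.
Qed.

Lemma mutual_invertible v : in2 v = x -> mutual (in1 v) x = dbraid v v.
Proof.
move=> e; rewrite /mutual (big_pred1 v) // => w /=; rewrite /src1 /src2.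
apply/andP/eqP => [[/eqP e1 /eqP e2]|->]; last by rewrite e eqxx.
exact: invertible_uniq.
Qed.

Lemma strace_invertible a : strace a x = qdim a * mutual a x.
Proof.
rewrite /strace /mutual big_distrr; apply: eq_bigr => v /andP[/eqP e1 /eqP e2].
by rewrite (qdim_out e2) e1.
Qed.

Lemma norm_mutual a : `|mutual a x| = 1.
Proof.
have [v [<- e2]] := invertible_vertex a; rewrite (mutual_invertible e2) /dbraid.
have [u nz] := R_exists v; have [k1 k2 _] := R_labels nz.
have uu w : R v w != 0 -> w = u.
  by move=> /R_labels[k3 k4 _]; apply: invertible_uniq'; congruence.
rewrite (big_single (i := u)) => [|w]; last first.
  by rewrite mulf_eq0 negb_or => /andP[/uu].
have h1 : R v u * (R v u)^* = 1.
  have := R_unitary1 v v; rewrite eqxx (big_single (i := u)) // => w.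
  by rewrite mulf_eq0 negb_or => /andP[/uu].
have h2 : R u v * (R u v)^* = 1.
  have := R_unitary1 u u; rewrite eqxx (big_single (i := v)) // => w.
  rewrite mulf_eq0 negb_or => /andP[/R_labels[k3 k4 _] _].
  by apply: invertible_uniq; congruence.
have n1 (z : K) : z * z^* = 1 -> `|z| = 1.
  rewrite -normCK => /eqP; rewrite sqrf_eq1 => /orP[/eqP//|/eqP e].
  by have := normr_ge0 z; rewrite e ler0N1.
by rewrite normrM !n1 ?mulr1.
Qed.

End InvertibleObject.

End Invertible.

(** * A fermion fixes no object with which it braids trivially *)

Section Fermion.

Variables (K : numClosedFieldType) (B : ubfc K).
Implicit Types (a b c : obj B) (al be ga mu nu la ps si v w : vtx B).
Local Notation in1 := (@in1 (obj B) (vtx B) bd).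
Local Notation in2 := (@in2 (obj B) (vtx B) bd).
Local Notation out := (@out (obj B) (vtx B) bd).
Local Notation one := (@Defs.one K B).
Local Notation F := (@Fsym K B).
Local Notation R := (@Rsym K B).

(* The hexagon with total charge 1. *)
Lemma hexagon_rot S al mu : braiding_labels S -> hexagon_eq S ->
  \sum_la \sum_ga S al la * rot la ga * S ga mu =
  \sum_de rot al de * S (cup (dual (out de))) (cup (out de)) * rot de mu.
Proof.
move=> lS hS.
transitivity (\sum_la \sum_ga S al la * F la (cup (out al)) ga (cup (in2 al)) *
  S ga mu).
  apply: eq_bigr => la _; apply: eq_bigr => ga _.
  by have [->|/lS[_ -> ->]] := eqVneq (S al la) 0; rewrite ?mul0r.
rewrite hS; apply: eq_bigr => de _.
rewrite (big_single (i := cup (in1 al))) => [|si]; last first.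
  apply: contraNeq => ne; rewrite big1 // => ps _.
  have [->|/F_labels] := eqVneq (F al (cup (out al)) de si) 0;
    first by rewrite !mul0r.
  rewrite !labE => -[_ _ /esym e1 [_ _ /esym e2]].
  by rewrite (out_one e2 e1) eqxx in ne.
rewrite -/(rot al de).
have [->|/rot_labels[e1 e2 e3]] := eqVneq (rot al de) 0.
  by rewrite !mul0r big1 // => ps _; rewrite !mul0r.
rewrite (big_single (i := cup (out de))) => [|ps].
  by rewrite /rot e3 dualK e1.
rewrite !mulf_eq0 !negb_or -andbA => /and3P[_ /lS[]].
by rewrite !labE => _ e4 /esym e5 _; apply: out_one => //; rewrite e3.
Qed.

Lemma rot_exists v : exists w, rot v w != 0.
Proof.
have := rot_unitary v v; rewrite eqxx => h.
apply/existsP; apply: contraT; rewrite negb_exists => /forallP h0.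
have /eqP := oner_neq0 K; case; rewrite -[LHS]h big1 // => w _.
by have := h0 w; rewrite negbK => /eqP ->; rewrite mul0r.
Qed.

Lemma rot_inj v w : in2 v = in2 w -> out v = out w ->
  (forall u u', in1 u = in2 v -> in2 u = dual (out v) ->
     in1 u' = in2 v -> in2 u' = dual (out v) -> u = u') -> v = w.
Proof.
move=> e1 e2 un; have [v1 nv] := rot_exists v; have [w1 nw] := rot_exists w.
have [k1 k2 _] := rot_labels nv; have [l1 l2 _] := rot_labels nw.
have e : w1 = v1 by apply: un; congruence.
apply/eqP; apply: contraT => ne; have := rot_unitary v w.
rewrite (negbTE ne) (big_single (i := v1)) => [|u].
  by move/eqP; rewrite mulf_eq0 conjC_eq0 (negbTE nv) -e (negbTE nw).
rewrite mulf_eq0 negb_or => /andP[/rot_labels[k3 k4 _] _].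
by apply: un; congruence.
Qed.

Variables (psi : obj B).
Hypothesis hpsi : qdim psi = 1.
Hypothesis psi_dual : dual psi = psi.
Hypothesis psi_fermion : R (cup psi) (cup psi) = -1.

(** In the hexagon for three fermions the two exchange signs cancel, leaving f = f^2 for the zig-zag
    scalar f. *)
Lemma rigidF_fermion : rigidF psi = 1.
Proof.
have nz := rigidF_neq0 psi; apply: (mulfI nz); rewrite mulr1.
have := hexagon (cup psi) (unitl psi) (cup psi) (unitr psi).
rewrite (big_single (i := cup psi)) => [|la]; last first.
  apply: contraNeq => ne; rewrite big1 // => ga _.
  have [->|/R_labels] := eqVneq (R (cup psi) la) 0; first by rewrite !mul0r.
  by rewrite !labE psi_dual => -[_ /esym e1 /esym e2];
    rewrite (out_one e2 e1) eqxx in ne.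
rewrite (big_single (i := cup psi)) => [|ga]; last first.
  rewrite mulf_eq0 negb_or => /andP[_ /R_labels];
    rewrite !labE psi_dual => -[e1 _ e2].
  exact: out_one.
rewrite (big_single (i := cup psi)) => [|de]; last first.
  apply: contraNeq => ne; rewrite big1 // => si _; rewrite big1 // => ps _.
  have [->|/F_labels] := eqVneq (F (cup psi) (unitl psi) de si) 0.
    by rewrite !mul0r.
  rewrite !labE psi_dual => -[_ _ _ [/esym e1 /esym e2 _]].
  by case/eqP: ne; apply: (invertible_uniq hpsi); rewrite ?labE.
rewrite (big_single (i := unitr psi)) => [|si]; last first.
  apply: contraNeq => ne; rewrite big1 // => ps _.
  have [->|/F_labels] := eqVneq (F (cup psi) (unitl psi) (cup psi) si) 0.
    by rewrite !mul0r.
  by rewrite !labE => -[_ /esym e1 /esym e2 _]; rewrite (in2_one e1 e2) eqxx in ne.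
rewrite (big_single (i := unitl psi)) => [|ps]; last first.
  rewrite !mulf_eq0 !negb_or -andbA => /and3P[_ /R_labels + _].
  by rewrite !labE => -[_ /esym e1 /esym e2]; apply: in1_one_out.
have -> : F (cup psi) (unitl psi) (cup psi) (unitr psi) = rigidF psi.
  by rewrite /rigidF psi_dual.
by rewrite psi_fermion R_unitr mulr1 mulrN1 mulN1r opprK.
Qed.

(** Here the phase of [rot_cube] comes from f(a) f(dual a) / f(psi), which is |f(a)|^2 > 0, so a
    full turn is trivial. *)
Lemma rot_cube_fermion v1 v2 v3 : out v1 = psi -> in2 v1 = dual (in1 v1) ->
  (forall w, rot v1 w != 0 -> w = v2) -> (forall w, rot v2 w != 0 -> w = v3) ->
  rot v1 v2 * rot v2 v3 * rot v3 v1 = 1.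
Proof.
move=> e1 e2 h1 h2.
have := congr1 (fun A => entry A v1 v1) (@rot_cube _ B).
rewrite entry_dmx eqxx mulr1n /= -mulmxA entry_mul (big_single (i := v2)) => [|w].
  rewrite entry_mul (big_single (i := v3)) => [|w].
    rewrite !entry_lmx mulrA => ->.
    rewrite /rigidity_factor e1 e2 rigidF_dual rigidF_fermion invr1 mulr1.
    rewrite norm_conjC conjCK normrM norm_conjC -expr2 normCK divff //.
    by rewrite mulf_neq0 ?conjC_eq0 ?rigidF_neq0.
  by rewrite entry_lmx mulf_eq0 negb_or => /andP[/h2].
by rewrite entry_lmx mulf_eq0 negb_or => /andP[/h1].
Qed.

(** If psi x = x, all relevant vertex spaces are one-dimensional and the hexagons become scalar
    identities. With trivial double braid their product reads 1 = -1, the sign being the exchange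
    phase of psi. *)
Lemma fermion_not_fixed u2 : in2 u2 = psi -> out u2 = in1 u2 ->
  mutual (in1 u2) psi <> 1.
Proof.
set x := in1 u2 => e22 e23 hM.
have e21 : in1 u2 = x by [].
(* [u1], [u2], [u3] are the rotations of (x, psi; x) and [v1], [v2], [v3] those of its mirror image;
   R relates [u1], [u2], [u3] to [v1], [v3], [v2]. *)
have [u3 /rot_labels] := rot_exists u2; rewrite e21 e22 e23 => -[e31 e32 e33].
have [u1 /rot_labels] := rot_exists u3;
  rewrite e31 e32 e33 dualK psi_dual => -[e11 e12 e13].
have [v3 /R_labels] := R_exists u2;
  rewrite e21 e22 e23 => -[/esym f32 /esym f31 /esym f33].
have [v2 /R_labels] := R_exists u3;
  rewrite e31 e32 e33 => -[/esym f22 /esym f21 /esym f23].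
have [v1 /R_labels] := R_exists u1;
  rewrite e11 e12 e13 => -[/esym f12 /esym f11 /esym f13].
have dxx := dualK x.
have uq := invertible_uniq hpsi; have uq' := invertible_uniq' hpsi.
have uu1 w : in2 w = x -> out w = psi -> w = u1.
  move=> h2 h3; apply: rot_inj; rewrite ?e12 ?e13 // => t t'.
  by rewrite h2 h3 psi_dual => *; apply: uq; congruence.
have uv1 w : in2 w = dual x -> out w = psi -> w = v1.
  move=> h2 h3; apply: rot_inj; rewrite ?f12 ?f13 // => t t'.
  by rewrite h2 h3 psi_dual => *; apply: uq; congruence.
have uu2 w : in1 w = x -> in2 w = psi -> w = u2 by move=> *; apply: uq; congruence.
have uv2 w : in1 w = dual x -> in2 w = psi -> w = v2 by move=> *; apply: uq;
  congruence.
have uv3 w : in1 w = psi -> in2 w = x -> w = v3 by move=> *; apply: uq'; congruence.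
have uu3 w : in1 w = psi -> in2 w = dual x -> w = u3 by move=> *; apply: uq';
  congruence.
have hex S al mu la ga de : braiding_labels S -> hexagon_eq S ->
   (forall w, S al w != 0 -> w = la) -> (forall w, S w mu != 0 -> w = ga) ->
   (forall w, rot al w != 0 -> w = de) ->
   S al la * rot la ga * S ga mu =
   rot al de * S (cup (dual (out de))) (cup (out de)) * rot de mu.
  move=> lS hS h1 h2 h3; have := hexagon_rot al mu lS hS.
  rewrite (big_single (i := la)) => [|w].
    rewrite (big_single (i := ga)) => [->|w].
      rewrite (big_single (i := de)) // => w.
      by rewrite !mulf_eq0 !negb_or -andbA => /and3P[/h3].
    by rewrite !mulf_eq0 !negb_or => /andP[_ /h2].
  apply: contraNeq => ne; rewrite big1 // => t _.
  have [->|/h1 e] := eqVneq (S al w) 0; first by rewrite !mul0r.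
  by rewrite e eqxx in ne.
have unit v u : (forall w, R v w != 0 -> w = u) -> R v u * (R v u)^* = 1.
  move=> h; have := R_unitary1 v v; rewrite eqxx (big_single (i := u)) // => w.
  by rewrite mulf_eq0 negb_or => /andP[/h].
have Lu S w : braiding_labels S -> S v1 w != 0 -> w = u1.
  by move=> lS /lS[k1 k2 k3]; apply: uu1; congruence.
have Lu3 S w : braiding_labels S -> S v2 w != 0 -> w = u3.
  by move=> lS /lS[k1 k2 k3]; apply: uu3; congruence.
have lR := @braiding_labels_R _ B; have lRi := @braiding_labels_Rinv _ B.
have alpha : R v1 u1 * rot u1 u2 * R u2 v3 =
    rot v1 v2 * R (cup x) (cup (dual x)) * rot v2 v3.
  have := hex R v1 v3 u1 u2 v2 lR (@hexagon _ B) (Lu _ ^~ lR).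
  rewrite f23 dualK; apply=> w.
    by move=> /lR[k1 k2 k3]; apply: uu2; congruence.
  by move=> /rot_labels[k1 k2 k3]; apply: uv2; congruence.
have gamma : R v3 u2 * rot u2 u3 * R u3 v2 = rot v3 v1 * -1 * rot v1 v2.
  have := hex R v3 v2 u2 u3 v1 lR (@hexagon _ B).
  rewrite f13 psi_dual psi_fermion; apply=> w.
  - by move=> /lR[k1 k2 k3]; apply: uu2; congruence.
  - by move=> /lR[k1 k2 k3]; apply: uu3; congruence.
  by move=> /rot_labels[k1 k2 k3]; apply: uv1; congruence.
have beta : (R u3 v2)^* * rot u3 u1 * (R v1 u1)^* =
    rot v2 v3 * (R (cup x) (cup (dual x)))^* * rot v3 v1.
  have := hex _ v2 v1 u3 u1 v3 lRi (@hexagon_inv _ B) (Lu3 _ ^~ lRi).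
  rewrite f33; apply=> w.
    by move=> /lRi[k1 k2 k3]; apply: uu1; congruence.
  by move=> /rot_labels[k1 k2 k3]; apply: uv3; congruence.
have Z1 : rot v1 v2 * rot v2 v3 * rot v3 v1 = 1.
  apply: rot_cube_fermion; rewrite ?f12 ?f11 ?f13 // => w /rot_labels[k1 k2 k3].
    by apply: uv2; congruence.
  by apply: uv3; congruence.
have Z2 : rot u1 u2 * rot u2 u3 * rot u3 u1 = 1.
  apply: rot_cube_fermion;
    rewrite ?e11 ?e12 ?e13 ?dualK // => w /rot_labels[k1 k2 k3].
    by apply: uu2; congruence.
  by apply: uu3; congruence.
have M1 : R u2 v3 * R v3 u2 = 1.
  rewrite -hM (mutual_invertible hpsi e22) /dbraid (big_single (i := v3)) // => w.
  rewrite mulf_eq0 negb_or => /andP[/R_labels[k1 k2 k3] _].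
  by apply: uv3; congruence.
have U1 := unit v1 u1 (Lu _ ^~ lR).
have U6 : R u3 v2 * (R u3 v2)^* = 1.
  by apply: unit => w /R_labels[k1 k2 k3]; apply: uv2; congruence.
have Ut : R (cup x) (cup (dual x)) * (R (cup x) (cup (dual x)))^* = 1.
  apply: unit => w /R_labels[]; rewrite !labE => _ /esym k2 /esym k3.
  by apply: out_one.
(* Multiply the three hexagons. On the left the R-factors pair into norms and the double braid, and
   one full turn remains: the value is 1. On the right there are two full turns, a norm and the
   fermionic sign: the value is -1. *)
have : (R v1 u1 * rot u1 u2 * R u2 v3) * (R v3 u2 * rot u2 u3 * R u3 v2) *
   ((R u3 v2)^* * rot u3 u1 * (R v1 u1)^*) = 1.
  transitivity ((R v1 u1 * (R v1 u1)^*) * (R u3 v2 * (R u3 v2)^*) *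
    (R u2 v3 * R v3 u2) * (rot u1 u2 * rot u2 u3 * rot u3 u1)); first ring.
  by rewrite U1 U6 M1 Z2 !mulr1.
rewrite alpha gamma beta.
have -> : rot v1 v2 * R (cup x) (cup (dual x)) * rot v2 v3 *
  (rot v3 v1 * -1 * rot v1 v2) *
  (rot v2 v3 * (R (cup x) (cup (dual x)))^* * rot v3 v1) =
   - ((R (cup x) (cup (dual x)) * (R (cup x) (cup (dual x)))^*) *
     (rot v1 v2 * rot v2 v3 * rot v3 v1) ^+ 2) by ring.
rewrite Ut Z1 expr1n mulr1 => /eqP; rewrite eq_sym -addr_eq0 -mulr2n.
by rewrite pnatr_eq0.
Qed.

End Fermion.

(** * Characters of the fusion ring *)

Section PhaseCharacters.

Variables (K : numClosedFieldType) (B : ubfc K).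
Implicit Types (a b c x : obj B) (v w : vtx B) (z : obj B -> K).
Local Notation in1 := (@in1 (obj B) (vtx B) bd).
Local Notation in2 := (@in2 (obj B) (vtx B) bd).
Local Notation out := (@out (obj B) (vtx B) bd).
Local Notation one := (@Defs.one K B).

Lemma inKP z : inK z <-> phases z /\ forall v, z (in1 v) * z (in2 v) = z (out v).
Proof.
split=> -[hp h].
  split=> // v; apply: h; apply/card_gt0P; exists v.
  by rewrite inE /Defs.in1 /Defs.in2 /Defs.out; case: (bd v) => [[]].
split=> // a b c /card_gt0P[v].
by rewrite inE => /eqP e; have := h v; rewrite /Defs.in1 /Defs.in2 /Defs.out e.
Qed.

Lemma phase_conj (u : K) : `|u| = 1 -> u * u^* = 1.
Proof. by move=> h; rewrite -normCK h expr1n. Qed.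

Lemma phase_neq0 (u : K) : `|u| = 1 -> u != 0.
Proof. by move=> h; rewrite -normr_eq0 h oner_eq0. Qed.

(* Unit vectors whose weighted mean is a unit vector are all equal. *)
Lemma phases_inK z : phases z ->
  (forall a b, (qdim a * z a) * (qdim b * z b) =
     \sum_(v | (in1 v == a) && (in2 v == b)) qdim (out v) * z (out v)) ->
  inK z.
Proof.
move=> hz hm; apply/inKP; split=> // v.
set a := in1 v; set b := in2 v; set u := z a * z b.
have hu : u * u^* = 1 by apply: phase_conj; rewrite normrM !hz mulr1.
pose P w := (in1 w == a) && (in2 w == b).
have e0 : \sum_(w | P w) qdim (out w) * `|u - z (out w)| ^+ 2 = 0.
  have e1 : \sum_(w | P w) qdim (out w) = qdim a * qdim b by rewrite qdimM.
  have e2 : \sum_(w | P w) qdim (out w) * z (out w) = qdim a * qdim b * u.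
    by rewrite -hm /u; ring.
  have e3 : \sum_(w | P w) qdim (out w) * (z (out w))^* = qdim a * qdim b * u^*.
    have := congr1 Num.conj e2; rewrite rmorph_sum !rmorphM /=.
    rewrite !(conj_Creal (ger0_real (ltW (qdim_gt0 _)))) => <-.
    apply: eq_bigr => w _; rewrite rmorphM /=.
    by rewrite (conj_Creal (ger0_real (ltW (qdim_gt0 _)))).
  transitivity (\sum_(w | P w) (2 * qdim (out w)
      - u * (qdim (out w) * (z (out w))^* ) - u^* * (qdim (out w) * z (out w)))).
    apply: eq_bigr => w _; rewrite normCK rmorphB /=.
    have := phase_conj (hz (out w)) => h.
    transitivity (qdim (out w) * (u * u^* + z (out w) * (z (out w))^* 
      - u * (z (out w))^* - u^* * z (out w))); first ring.
    by rewrite hu h; ring.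
  rewrite !sumrB -!big_distrr /= e1 e2 e3.
  transitivity (2 * (qdim a * qdim b) * (1 - u * u^*)); first ring.
  by rewrite hu subrr mulr0.
have pos w : P w -> 0 <= qdim (out w) * `|u - z (out w)| ^+ 2.
  by move=> _; rewrite mulr_ge0 ?(ltW (qdim_gt0 _)) // exprn_ge0.
move/eqP: e0; rewrite psumr_eq0 // => /allP/(_ v);
  rewrite mem_index_enum => /(_ isT).
rewrite /P !eqxx /= mulf_eq0 (gt_eqF (qdim_gt0 _)) /= sqrf_eq0 normr_eq0 subr_eq0.
by move/eqP.
Qed.

(** For Abelian [x] the Verlinde formula says that M_{a,x} M_{b,x} is the weighted mean of the
    phases M_{c,x} over the channels c of a and b. *)
Lemma mutual_inK x : qdim x = 1 -> inK (fun a => mutual a x).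
Proof.
move=> hx; apply: phases_inK => [a|a b]; first exact: norm_mutual.
rewrite -!strace_invertible // [strace b x]strace_sym verlinde hx mul1r.
by apply: eq_bigr => v _; rewrite strace_sym strace_invertible.
Qed.

Lemma inK_one z : inK z -> z one = 1.
Proof.
move/inKP=> [hp /(_ (unitl one))]; rewrite !labE => h.
by apply: (mulfI (phase_neq0 (hp one))); rewrite h mulr1.
Qed.

Lemma inK_dual z a : inK z -> z (dual a) = (z a)^*.
Proof.
move=> hz; have := inK_one hz; have /inKP[hp /(_ (cup a))] := hz.
rewrite !labE => <- h; apply: (mulfI (phase_neq0 (hp a))).
by rewrite h phase_conj.
Qed.

Lemma inKM z z' : inK z -> inK z' -> inK (fun a => z a * z' a).
Proof.
move=> /inKP[hp h] /inKP[hp' h']; apply/inKP; split=> [a|v].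
  by rewrite normrM hp hp' mulr1.
by rewrite -h -h' mulrACA.
Qed.

Lemma inKV z : inK z -> inK (fun a => (z a)^-1).
Proof.
move=> /inKP[hp h]; apply/inKP; split=> [a|v]; first by rewrite normfV hp invr1.
by rewrite -h invfM.
Qed.

Hypothesis hmod : modular B.

Lemma dimsq_gt0 : 0 < dimsq B.
Proof.
rewrite /dimsq (bigD1 one) //= qdim_one expr1n.
by apply: ltr_wpDr => //; apply: sumr_ge0 => a _;
  rewrite exprn_ge0 // ltW ?qdim_gt0.
Qed.

Lemma strace_unitary a b :
  \sum_c strace a c * (strace b c)^* = dimsq B *+ (a == b).
Proof.
have D0 := dimsq_gt0.
have sD : sqrtC (dimsq B) != 0 by rewrite sqrtC_eq0 gt_eqF.
have sR : (sqrtC (dimsq B))^* = sqrtC (dimsq B).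
  by rewrite conj_Creal // ger0_real // sqrtC_ge0 ltW.
have := hmod a b => /(congr1 (fun t => dimsq B * t)); rewrite mulr_natr => <-.
rewrite big_distrr; apply: eq_bigr => c _ /=.
rewrite /Smat -!/(strace _ _) rmorphM fmorphV /= sR -{1}[dimsq B]sqrtCK.
by rewrite expr2; field.
Qed.

End PhaseCharacters.

(** * Minimal modular extensions *)

Section ModularExtension.

Variables (K : numClosedFieldType) (C X : ubfc K) (i : full_subcat C X).
Implicit Types (a b c : obj C) (x y : obj X) (v w : vtx C).
Local Notation in1C := (@in1 (obj C) (vtx C) bd).
Local Notation in2C := (@in2 (obj C) (vtx C) bd).
Local Notation outC := (@out (obj C) (vtx C) bd).
Local Notation in1 := (@in1 (obj X) (vtx X) bd).
Local Notation in2 := (@in2 (obj X) (vtx X) bd).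
Local Notation out := (@out (obj X) (vtx X) bd).
Local Notation one B := (@Defs.one K B).
Local Notation ev := (embv i).

Lemma in1_embv v : in1 (ev v) = i (in1C v).
Proof. by rewrite /Defs.in1 emb_bd. Qed.
Lemma in2_embv v : in2 (ev v) = i (in2C v).
Proof. by rewrite /Defs.in2 emb_bd. Qed.
Lemma out_embv v : out (ev v) = i (outC v).
Proof. by rewrite /Defs.out emb_bd. Qed.
Definition embvE := (in1_embv, in2_embv, out_embv).

Lemma embv_unitl a : ev (unitl a) = unitl (i a).
Proof. by apply: in1_one; rewrite embvE labE // emb_one. Qed.
Lemma embv_unitr a : ev (unitr a) = unitr (i a).
Proof. by apply: in2_one; rewrite embvE labE // emb_one. Qed.
Lemma embv_cup a : ev (cup a) = cup (i a).
Proof. by apply: out_one; rewrite embvE labE // emb_one. Qed.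
Lemma emb_dual a : i (dual a) = dual (i a).
Proof. by rewrite -[RHS]in2_cup -embv_cup embvE labE. Qed.

Lemma emb_qdim a : qdim (i a) = qdim a.
Proof.
by rewrite /qdim -emb_dual -!embv_cup -embv_unitl -embv_unitr emb_F.
Qed.

Lemma emb_vertices a b (Phi : vtx X -> K) :
  \sum_(w | (in1 w == i a) && (in2 w == i b)) Phi w =
  \sum_(v | (in1C v == a) && (in2C v == b)) Phi (ev v).
Proof.
transitivity (\sum_(w in ev @: [set v | (in1C v == a) && (in2C v == b)]) Phi w).
  apply: eq_bigl => w; apply/andP/imsetP => [[/eqP e1 /eqP e2]|[v]].
    have [v e] := emb_full e1 e2; exists v => //; rewrite inE.
    by move: e1 e2; rewrite e !embvE => /emb_inj -> /emb_inj ->; rewrite !eqxx.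
  by rewrite inE => /andP[/eqP e1 /eqP e2] ->; rewrite !embvE e1 e2 !eqxx.
rewrite big_imset /=; last by move=> v v' _ _; apply: embv_inj.
by apply: eq_bigl => v; rewrite inE.
Qed.

Lemma emb_dbraid v : dbraid (ev v) (ev v) = dbraid v v.
Proof.
transitivity (\sum_(w | (in1 w == i (in2C v)) && (in2 w == i (in1C v)))
    Rsym (ev v) w * Rsym w (ev v)).
  rewrite [RHS]big_mkcond; apply: eq_bigr => w _; case: ifP => // no.
  apply/eqP/negPn/negP; rewrite mulf_eq0 negb_or => /andP[/R_labels[+ + _] _].
  by rewrite !embvE => e1 e2; rewrite e1 e2 !eqxx in no.
rewrite emb_vertices big_mkcond; apply: eq_bigr => w _; rewrite !emb_R.
case: ifP => // no; apply/esym/eqP/negPn/negP; rewrite mulf_eq0 negb_or.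
by move=> /andP[/R_labels[e1 e2 _] _]; rewrite e1 e2 !eqxx in no.
Qed.

Lemma emb_strace a b : strace (i a) (i b) = strace a b.
Proof.
rewrite /strace emb_vertices; apply: eq_bigr => v _.
by rewrite embvE emb_qdim emb_dbraid.
Qed.

Variable psi : obj C.
Hypothesis hC : super_modular psi.
Hypothesis hX : minimal_modular_ext i.
Local Notation Psi := (i psi).

Let fus v : in1C v = psi -> in2C v = psi -> outC v = one C.
Proof.
move=> e1 e2; have [_ _ _ /(_ (outC v)) h] := hC.
suff : (0 < fusN psi psi (outC v))%N by rewrite h lt0b => /eqP.
apply/card_gt0P; exists v; move: e1 e2.
by rewrite inE /Defs.in1 /Defs.in2 /Defs.out; case: (bd v) => [[a b] c] /= -> ->.
Qed.

Lemma fermion_dual : dual psi = psi.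
Proof.
have [_ _ _ /(_ (one C))] := hC; rewrite eqxx => h.
have /card_gt0P[v] : (0 < fusN psi psi (one C))%N by rewrite h.
rewrite inE => /eqP e; have e1 : outC v = one C by rewrite /Defs.out e.
have e2 : in1C v = psi by rewrite /Defs.in1 e.
have := congr1 in2C (out_one e1 e2); rewrite labE => <-.
by rewrite /Defs.in2 e.
Qed.

Lemma fermion_qdim : qdim psi = 1.
Proof.
have := qdimM psi psi; rewrite (big_pred1 (cup psi)) => [|v].
  rewrite labE qdim_one -expr2 => /eqP; rewrite sqrf_eq1 => /orP[/eqP//|/eqP e].
  by have := qdim_gt0 psi; rewrite e ltr0N1.
apply/andP/eqP => [[/eqP e1 /eqP e2]|->]; last by rewrite !labE fermion_dual eqxx.
by apply: out_one => //; apply: fus.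
Qed.

Lemma fermion_R : Rsym (cup psi) (cup psi) = -1.
Proof.
have [_ _ <- _] := hC; rewrite /twist (big_pred1 (cup psi)) => [|v].
  by rewrite /tgt out_cup qdim_one fermion_qdim divr1 mul1r.
apply/andP/eqP => [[/eqP e1 /eqP e2]|->].
  by apply: out_one => //; apply: fus.
by rewrite /src1 /src2 !labE fermion_dual eqxx.
Qed.

Lemma emb_fermion_dual : dual Psi = Psi.
Proof. by rewrite -emb_dual fermion_dual. Qed.
Lemma emb_fermion_qdim : qdim Psi = 1.
Proof. by rewrite emb_qdim fermion_qdim. Qed.
Lemma emb_fermion_R : Rsym (cup Psi) (cup Psi) = -1.
Proof. by rewrite -embv_cup emb_R fermion_R. Qed.

Lemma emb_fermion_neq1 : Psi != one X.
Proof.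
have [ne _ _ _] := hC; apply: contra ne; rewrite -(emb_one i) => /eqP/emb_inj ->.
exact: eqxx.
Qed.

Lemma mutual_emb c : mutual (i c) Psi = 1.
Proof.
have [_ tr _ _] := hC; have := (tr psi).2 (or_intror erefl) => tr_psi.
apply: (mulfI (lt0r_neq0 (qdim_gt0 (i c)))).
rewrite -strace_invertible ?emb_fermion_qdim // strace_sym emb_strace /strace.
rewrite mulr1 emb_qdim -[RHS]mul1r -fermion_qdim qdimM.
apply: eq_bigr => v /andP[/eqP e1 _].
by rewrite tr_psi // eqxx mulr1.
Qed.

Lemma mutual_fermion_sq x : mutual x Psi ^+ 2 = 1.
Proof.
have hq := emb_fermion_qdim.
have := verlinde Psi Psi x; rewrite (strace_sym Psi) strace_invertible //.
rewrite (big_pred1 (cup Psi)) => [|v].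
  rewrite labE strace_one => h.
  apply: (mulfI (lt0r_neq0 (qdim_gt0 x))); apply: (mulfI (lt0r_neq0 (qdim_gt0 x))).
  by rewrite mulr1 -h; ring.
apply/andP/eqP => [[/eqP e1 /eqP e2]|->];
  last by rewrite !labE emb_fermion_dual eqxx.
by apply: (invertible_uniq hq); rewrite ?labE ?emb_fermion_dual.
Qed.

Lemma mutual_fermion_sign x : mutual x Psi = 1 \/ mutual x Psi = -1.
Proof.
by have /eqP := mutual_fermion_sq x; rewrite sqrf_eq1 => /orP[]/eqP ->;
  [left|right].
Qed.

Lemma qdim_conj (B : ubfc K) (a : obj B) : (qdim a)^* = qdim a.
Proof. by rewrite conj_Creal // ger0_real // ltW ?qdim_gt0. Qed.

(* The objects braiding trivially with [psi] contribute half of the total     *)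
(* dimension, which is already the contribution of [C].                       *)
Lemma mutual_fermion_eq1 x : mutual x Psi = 1 -> exists c, x = i c.
Proof.
move=> hx; have [hmod hdim] := hX.
have [/imageP[c _ ->]|no] := boolP (x \in codom i); first by exists c.
(* Orthogonality of the rows psi and 1 of the S-matrix. *)
have h0 : \sum_y qdim y ^+ 2 * mutual y Psi = 0.
  have := strace_unitary hmod Psi (one X);
    rewrite (negbTE emb_fermion_neq1) mulr0n => h.
  rewrite -[RHS]h; apply: eq_bigr => y _;
    rewrite !(strace_sym _ y) strace_one strace_invertible ?emb_fermion_qdim //.
  by rewrite qdim_conj; ring.
have h1 : \sum_(y | y \in codom i) qdim y ^+ 2 = dimsq C.
  rewrite (eq_bigl (mem (i @: setT))) => [|y].
    rewrite big_imset /=; last by move=> c c' _ _; apply: emb_inj.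
    by apply: eq_big => [c|c _]; rewrite ?inE ?emb_qdim.
  by apply/imageP/imsetP => [[c _ ->]|[c _ ->]]; exists c; rewrite ?inE.
(* The objects of C already account for 2 dim C = dim X, so the remaining nonnegative terms sum to
   0. *)
have h2 : \sum_(y | y \notin codom i) qdim y ^+ 2 * (1 + mutual y Psi) = 0.
  have : \sum_y qdim y ^+ 2 * (1 + mutual y Psi) = 2 * dimsq C.
    under eq_bigr => y _ do rewrite mulrDr mulr1.
    by rewrite big_split /= h0 addr0 -hdim.
  rewrite (bigID (mem (codom i))) /= -h1 => /(congr1 (fun t => t - 2 *
    \sum_(y | y \in codom i) qdim y ^+ 2)).
  rewrite subrr => h; rewrite -[RHS]h addrAC.
  suff -> : \sum_(y in codom i) qdim y ^+ 2 * (1 + mutual y Psi) = 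
     2 * \sum_(y in codom i) qdim y ^+ 2 by rewrite subrr add0r.
  rewrite big_distrr; apply: eq_bigr => y /imageP[c _ ->] /=.
  by rewrite mutual_emb mulrC.
have pos y : y \notin codom i -> 0 <= qdim y ^+ 2 * (1 + mutual y Psi).
  move=> _; apply: mulr_ge0; first by rewrite exprn_ge0 // ltW ?qdim_gt0.
  by case: (mutual_fermion_sign y) => ->; rewrite ?subrr ?addr_ge0.
move/eqP: h2; rewrite psumr_eq0 // => /allP/(_ x);
  rewrite mem_index_enum => /(_ isT).
rewrite no hx /= mulf_eq0 sqrf_eq0 (gt_eqF (qdim_gt0 _)) /= -mulr2n.
by rewrite pnatr_eq0.
Qed.

(** * Extending a character of C that is trivial on the fermion *)

Section ExtendCharacter.

Variables (zeta : obj C -> K) (hzeta : inK zeta) (zeta_psi : zeta psi = 1).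

(** The inner product of column [x] of the S-matrix, restricted to C, with the character zeta
    weighted by dimensions. *)
Let w x := \sum_c strace (i c) x * ((zeta c)^* * qdim c).

Let zeta_norm c : zeta c * (zeta c)^* = 1.
Proof. by apply: phase_conj; case: hzeta. Qed.

(* Orthogonality of characters of the fusion ring of [C]. *)
Let strace_zeta x a : w x != 0 -> strace (i a) x = qdim x * (zeta a * qdim a).
Proof.
move=> nz; apply: (mulIf nz).
have /inKP[hp hm] := hzeta.
pose Phi c c' := strace x (i c') * ((zeta c)^* * qdim c).
(* Verlinde expands the product of S-entries; Frobenius reciprocity then moves [a] across, so that
   multiplicativity of zeta and of the dimensions can be used. *)
transitivity (qdim x * \sum_(v | in1C v == a) Phi (in2C v) (outC v)).
  rewrite /w big_distrr (eq_bigr (fun c => qdim x *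
    (\sum_(v | (in1C v == a) && (in2C v == c)) Phi (in2C v) (outC v)))).
    rewrite -big_distrr /=; congr (_ * _).
    by rewrite (partition_big in2C xpredT).
  move=> c _ /=; rewrite [LHS]mulrA (strace_sym (i c)) verlinde emb_vertices
    -[LHS]mulrA.
  congr (_ * _); rewrite big_distrl; apply: eq_bigr => v /andP[_ /eqP e2] /=.
  by rewrite /Phi e2 out_embv.
rewrite sum_dual_reindex.
rewrite (partition_big in2C xpredT) //= -mulrA; congr (_ * _).
rewrite /w big_distrr; apply: eq_bigr => c _ /=.
transitivity (strace x (i c) * ((zeta (dual a))^* * (zeta c)^* *
  \sum_(v | (in1C v == dual a) && (in2C v == c)) qdim (outC v))).
  rewrite !big_distrr; apply: eq_bigr => v /andP[/eqP e1 /eqP e2] /=.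
  by rewrite /Phi e2 -hm rmorphM /= e1 e2; ring.
rewrite -qdimM qdim_dual inK_dual // conjCK strace_sym; ring.
Qed.

Let w_eq x : w x != 0 -> w x = qdim x * dimsq C.
Proof.
move=> nz; rewrite /w /dimsq big_distrr; apply: eq_bigr => c _ /=.
rewrite (strace_zeta _ nz).
transitivity (qdim x * (zeta c * (zeta c)^*) * qdim c ^+ 2); first ring.
by rewrite zeta_norm mulr1.
Qed.

(** Parseval: the rows of S are orthogonal and zeta consists of phases. *)
Let w_norm : \sum_x w x * (w x)^* = dimsq X * dimsq C.
Proof.
have [hmod _] := hX.
transitivity (\sum_c \sum_c' ((zeta c)^* * qdim c) * (zeta c' * qdim c') *
   \sum_x strace (i c) x * (strace (i c') x)^*).
  transitivity (\sum_x \sum_c \sum_c' ((zeta c)^* * qdim c) * (zeta c' * qdim c') *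
     (strace (i c) x * (strace (i c') x)^*)).
    apply: eq_bigr => x _; rewrite /w rmorph_sum big_distrlr /=.
    apply: eq_bigr => c _; apply: eq_bigr => c' _.
    rewrite !rmorphM /= conjCK qdim_conj; ring.
  rewrite exchange_big; apply: eq_bigr => c _ /=.
  rewrite exchange_big; apply: eq_bigr => c' _ /=.
  by rewrite [RHS]big_distrr.
rewrite /dimsq -/(dimsq X) big_distrr; apply: eq_bigr => c _ /=.
rewrite (big_single (i := c)) => [|c'].
  rewrite strace_unitary // eqxx mulr1n.
  transitivity ((zeta c * (zeta c)^*) * (dimsq X * qdim c ^+ 2)); first ring.
  by rewrite zeta_norm mul1r.
rewrite strace_unitary // mulf_eq0 negb_or mulrb => /andP[_].
by case: (eqVneq (i c) (i c')) => [/emb_inj ->|]; rewrite ?eqxx.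
Qed.

Let w_dim : \sum_(x | w x != 0) qdim x ^+ 2 = 2.
Proof.
have [hmod hdim] := hX.
have D0 : dimsq C != 0.
  by rewrite /dimsq gt_eqF // dimsq_gt0.
apply: (mulIf D0); apply: (mulIf D0);
  rewrite -hdim -w_norm !big_distrl big_mkcond /=.
apply: eq_bigr => x _; case: ifP => [nz|/negbFE/eqP ->]; last by rewrite mul0r.
rewrite (w_eq nz) rmorphM /= qdim_conj.
have -> : (dimsq C)^* = dimsq C.
  by rewrite conj_Creal // ger0_real // ltW // dimsq_gt0.
by ring.
Qed.

(** By [w_dim] some column [x] of S is proportional to zeta on C. Its translate by psi is another,
    so 2 d_x^2 <= 2; hence [x] is Abelian and M_{-,x} extends zeta. *)
Lemma extend_character : exists z, inK z /\ extends i z zeta.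
Proof.
have hq := emb_fermion_qdim.
have [x nz] : exists x, w x != 0.
  apply/existsP; apply: contraT; rewrite negb_exists => /forallP h0.
  move: w_dim; rewrite big_pred0 => [/eqP|x]; last by rewrite (negbTE (h0 x)).
  by rewrite eq_sym pnatr_eq0.
have hx c := strace_zeta c nz.
suff x1 : qdim x = 1.
  exists (fun y => mutual y x); split; first exact: mutual_inK.
  move=> c; apply: (mulfI (lt0r_neq0 (qdim_gt0 (i c)))).
  by rewrite -strace_invertible // hx x1 mul1r emb_qdim mulrC.
(* [y] is psi times [x]. As psi is transparent to C, both have the same S-column on C and both count
   in [w_dim], unless they coincide; zeta_psi = 1 makes psi braid trivially with [x], which excludes
   that. *)
have [v [e1 e2]] := invertible_vertex hq x.
set y := out v.
have qy : qdim y = qdim x by rewrite /y (qdim_out hq e2) e1.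
have sy c : strace (i c) y = strace (i c) x.
  have := verlinde x Psi (i c); rewrite (big_pred1 v) => [|u]; last first.
    apply/andP/eqP => [[/eqP k1 /eqP k2]|->]; last by rewrite e1 e2 !eqxx.
    by apply: (invertible_uniq hq); rewrite ?e1.
  rewrite (strace_invertible hq (i c)) mutual_emb mulr1 mulrC => /(mulfI
    (lt0r_neq0 (qdim_gt0 _))) <-.
  exact: strace_sym.
have wy : w y = w x by apply: eq_bigr => c _; rewrite sy.
have [yx|ne] := eqVneq y x.
  have := @fermion_not_fixed _ X Psi hq emb_fermion_dual emb_fermion_R v e2.
  rewrite -/y yx e1 => /(_ erefl); case.
  apply: (mulfI (lt0r_neq0 (qdim_gt0 x))).
  by rewrite mulr1 -strace_invertible // strace_sym hx zeta_psi fermion_qdim !mulr1.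
have := w_dim; rewrite (bigD1 x) //= (bigD1 y) /=; last by rewrite wy nz.
rewrite qy addrA -mulr2n => h.
have h2 : qdim x ^+ 2 *+ 2 <= 2.
  rewrite -[X in _ <= X]h lerDl; apply: sumr_ge0 => u _.
  by rewrite exprn_ge0 // ltW ?qdim_gt0.
have : qdim x ^+ 2 <= 1 by rewrite -(@ler_pMn2r _ 2).
rewrite expr_le1 ?(ltW (qdim_gt0 _)) // => h3.
by apply/eqP; rewrite eq_le h3 qdim_ge1.
Qed.

End ExtendCharacter.

(** Otherwise the rows psi and 1 of the invertible S-matrix would coincide. *)
Lemma mutual_fermion_nontrivial : exists x, mutual x Psi = -1.
Proof.
have [hmod _] := hX.
have [/existsP[x /eqP e]|/existsPn h] := boolP [exists x, mutual x Psi == -1].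
  by exists x.
have h1 x : mutual x Psi = 1.
  by have [//|e] := mutual_fermion_sign x; have := h x; rewrite e eqxx.
have := strace_unitary hmod Psi (one X); have := strace_unitary hmod Psi Psi.
rewrite (negbTE emb_fermion_neq1) eqxx mulr1n mulr0n.
have -> : \sum_c strace Psi c * (strace Psi c)^*
    = \sum_c strace Psi c * (strace (one X) c)^*.
  apply: eq_bigr => c _; congr (_ * _^*).
  by rewrite !(strace_sym _ c) strace_one strace_invertible ?emb_fermion_qdim //
    h1 mulr1.
by move=> -> /eqP; rewrite gt_eqF // dimsq_gt0.
Qed.

(** Two vortices fuse into C, where [z] is 1; so z_x z_y = 1 for all vortices x and y, and [z] is a
    single sign on them. *)
Lemma kernel_character z : inK z -> (forall c, z (i c) = 1) ->
  (forall x, z x = 1) \/ (forall x, z x = mutual x Psi).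
Proof.
move=> hz hzC; have /inKP[hp hm] := hz.
have /inKP[_ hM] := mutual_inK emb_fermion_qdim.
have z1 x : mutual x Psi = 1 -> z x = 1 by move=> /mutual_fermion_eq1[c ->].
have zz x y : mutual x Psi = -1 -> mutual y Psi = -1 -> z x * z y = 1.
  move=> ex ey; have := qdimM x y.
  have [u /andP[/eqP e1 /eqP e2] _|no] :=
    pickP (fun u : vtx X => (in1 u == x) && (in2 u == y)).
    rewrite -e1 -e2 hm z1 // -hM e1 e2 ex ey; ring.
  rewrite big_pred0 // => /eqP.
  by rewrite mulf_eq0 !gt_eqF ?qdim_gt0.
have [x0 ex0] := mutual_fermion_nontrivial.
have := zz x0 x0 ex0 ex0; rewrite -expr2 => /eqP.
rewrite sqrf_eq1 => /orP[/eqP e|/eqP e]; [left|right] => x.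
  have [/z1//|ex] := mutual_fermion_sign x.
  by have := zz x0 x ex0 ex; rewrite e mul1r.
have [ex|ex] := mutual_fermion_sign x; rewrite ex; first exact: z1.
by have := zz x0 x ex0 ex; rewrite e mulN1r => <-; rewrite opprK.
Qed.

End ModularExtension.

(** * Symmetry actions and the obstruction *)

Section SymmetryActions.

Variables (K : numClosedFieldType) (B : ubfc K).
Implicit Types (a b c : obj B) (v w u : vtx B) (z : obj B -> K) (r : autodata B).
Local Notation in1 := (@in1 (obj B) (vtx B) bd).
Local Notation in2 := (@in2 (obj B) (vtx B) bd).
Local Notation out := (@out (obj B) (vtx B) bd).

Lemma sgmM s (x y : K) : sgm s (x * y) = sgm s x * sgm s y.
Proof. by case: s => //=; rewrite rmorphM. Qed.

Lemma sgmV s (x : K) : sgm s x^-1 = (sgm s x)^-1.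
Proof. by case: s => //=; rewrite fmorphV. Qed.

Lemma sgm1 s : sgm s (1 : K) = 1.
Proof. by case: s => //=; rewrite rmorph1. Qed.

Lemma sgmN1 s : sgm s (-1 : K) = -1.
Proof. by case: s => //=; rewrite rmorphN rmorph1. Qed.

Lemma sgm_eq0 s (x : K) : (sgm s x == 0) = (x == 0).
Proof. by case: s => //=; rewrite conjC_eq0. Qed.

Lemma sgmD s t (x : K) : sgm s (sgm t x) = sgm (s (+) t) x.
Proof. by case: s; case: t => //=; rewrite conjCK. Qed.

Lemma norm_sgm s (x : K) : `|sgm s x| = `|x|.
Proof. by case: s => //=; rewrite norm_conjC. Qed.

Lemma sgm_sum s (I : finType) (E : I -> K) : sgm s (\sum_j E j) =
  \sum_j sgm s (E j).
Proof. by case: s => //=; rewrite rmorph_sum. Qed.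

Lemma sgm_conj s (x : K) : sgm s x^* = (sgm s x)^*.
Proof. by case: s. Qed.

Lemma umx_labels p r v w : topological_autoeq p r -> umx r v w != 0 ->
  [/\ in1 w = lab r (in1 v), in2 w = lab r (in2 v) & out w = lab r (out v)].
Proof. by move=> hr /(umx_supp hr);
  rewrite /Defs.in1 /Defs.in2 /Defs.out => ->. Qed.

Lemma umx_row p r v : topological_autoeq p r -> exists w, umx r v w != 0.
Proof.
move=> hr; have := umx_unitary1 hr v v; rewrite eqxx => h.
apply/existsP; apply: contraT; rewrite negb_exists => /forallP h0.
have /eqP := oner_neq0 K; case; rewrite -[LHS]h big1 // => w _.
by have := h0 w; rewrite negbK => /eqP ->; rewrite mul0r.
Qed.

Lemma umx_col p r w : topological_autoeq p r -> exists v, umx r v w != 0.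
Proof.
move=> hr; have := umx_unitary2 hr w w; rewrite eqxx => h.
apply/existsP; apply: contraT; rewrite negb_exists => /forallP h0.
have /eqP := oner_neq0 K; case; rewrite -[LHS]h big1 // => v _.
by have := h0 v; rewrite negbK => /eqP ->; rewrite mulr0.
Qed.

Lemma inK_lab p r z : topological_autoeq p r -> inK z ->
  inK (fun a => z (lab r a)).
Proof.
move=> hr /inKP[hp hm]; apply/inKP; split=> [a|v]; first exact: hp.
by have [w /(umx_labels hr)[<- <- <-]] := umx_row v hr.
Qed.

Lemma inK_sgm s z : inK z -> inK (fun a => sgm s (z a)).
Proof.
move=> /inKP[hp hm]; apply/inKP; split=> [a|v]; first by rewrite norm_sgm.
by rewrite -sgmM hm.
Qed.

Variable G : groupType.
Variables (p : obj B) (rho : G -> autodata B) (x : G -> G -> obj B -> K).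
Hypothesis hrho : forall g, topological_autoeq p (rho g).
Hypothesis hx : decomposes_kappa rho x.

Lemma kappa_anti g h : anti (rho (g * h)%g) = anti (rho g) (+) anti (rho h).
Proof.
have [_ [/= + _ _]] := hx g h.
by case: (anti _); case: (anti _); case: (anti _).
Qed.

(** Natural isomorphisms fix all labels, so the mere existence of [x] makes the labels a group
    action. *)
Lemma kappa_lab g h a : lab (rho (g * h)%g) a = lab (rho g) (lab (rho h) a).
Proof.
have [_ [_ /= + _]] := hx g h.
move/(congr1 (fun s : {perm obj B} => s (lab (rho g) (lab (rho h) a)))).
by rewrite !permM perm1 !permK.
Qed.

Lemma lab1 a : lab (rho 1%g) a = a.
Proof.
by have := kappa_lab 1%g 1%g a; rewrite mul1g => /perm_inj <-.
Qed.

Lemma labV g a : lab (rho g^-1%g) (lab (rho g) a) = a.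
Proof. by rewrite -kappa_lab mulVg lab1. Qed.

Definition vertex_phase z v := z (in1 v) * z (in2 v) / z (out v).

Let U k : 'M[K]_#|vtx B| := lmx (umx (rho k)).
Let S g (A : 'M[K]_#|vtx B|) : 'M[K]_#|vtx B| :=
  lmx (fun v w => sgm (anti (rho g)) (entry A v w)).

Let SM g A A' : S g (A *m A') = S g A *m S g A'.
Proof.
apply: entry_inj => v w; rewrite entry_lmx !entry_mul sgm_sum.
by apply: eq_bigr => u _; rewrite !entry_lmx sgmM.
Qed.

Let S_dmx g d : S g (dmx d) = dmx (fun v => sgm (anti (rho g)) (d v)).
Proof.
apply: entry_inj => v w; rewrite entry_lmx !entry_dmx.
by case: eqP => // _; case: (anti _); rewrite //= rmorph0.
Qed.

Let S_hmx g A : hmx (S g A) = S g (hmx A).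
Proof.
by apply: entry_inj => v w; rewrite entry_hmx !entry_lmx entry_hmx sgm_conj.
Qed.

Let SS g h A : S g (S h A) = S (g * h)%g A.
Proof. by apply: entry_inj => v w; rewrite !entry_lmx sgmD kappa_anti. Qed.

Let U_unitary k : hmx (U k) *m U k = 1%:M.
Proof.
apply: entry_inj => v w; rewrite entry_mul entry1 -(umx_unitary2 (hrho k)).
by apply: eq_bigr => u _; rewrite entry_hmx !entry_lmx.
Qed.

Let SU_unitary g k : hmx (S g (U k)) *m S g (U k) = 1%:M.
Proof.
rewrite S_hmx -SM U_unitary -dmx1 S_dmx; apply: eq_dmx => v; exact: sgm1.
Qed.

(** The decomposition of kappa, solved by unitarity for the action of [g * h]. *)
Let kappa_mx g h : U (g * h)%g = S g (U h) *m U g *m dmx (vertex_phase (x g h)).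
Proof.
have [_ [_ _ /= hk]] := hx g h.
have E : hmx (U g) *m (hmx (S g (U h)) *m U (g * h)%g) = dmx (vertex_phase (x g h)).
  apply: entry_inj => v w; rewrite entry_mul entry_dmx.
  have := hk v w; rewrite -/(vertex_phase (x g h) v) mulr_natl => <-.
  apply: eq_bigr => u _; rewrite entry_hmx entry_lmx kappa_anti.
  rewrite addbK !sgmD addbb /=; congr (_ * _); rewrite entry_mul.
  by apply: eq_bigr => t _; rewrite sgmD addbK entry_hmx !entry_lmx sgm_conj.
rewrite -E -!mulmxA (mulmxA (U g)) (mulmx1C (U_unitary g)) mul1mx.
by rewrite (mulmxA (S g (U h))) (mulmx1C (SU_unitary g h)) mul1mx.
Qed.

Lemma kappa_umx g h v w :
  umx (rho (g * h)%g) v w =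
  (\sum_u sgm (anti (rho g)) (umx (rho h) v u) * umx (rho g) u w) *
    vertex_phase (x g h) w.
Proof.
have := congr1 (fun A => entry A v w) (kappa_mx g h).
rewrite entry_lmx entry_muld entry_mul => ->; congr (_ * _).
by apply: eq_bigr => u _; rewrite !entry_lmx.
Qed.

Lemma beta_norm g h a : `|x g h a| = 1.
Proof. by have [hp _] := hx g h; apply: hp. Qed.

Lemma beta_neq0 g h a : x g h a != 0.
Proof. exact/phase_neq0/beta_norm. Qed.

(* Comparison of the two ways to expand the action of [g * h * k]. *)
Lemma d2_inK g h k : inK (d2 rho x g h k).
Proof.
apply/inKP; split=> [a|w].
  by rewrite /d2 !normrM normfV !normrM norm_sgm !beta_norm !(mulr1, invr1).
have E : U g *m dmx (fun w => vertex_phase (x g h) w * vertex_phase (x (g *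
  h)%g k) w)
   = dmx (fun v => sgm (anti (rho g)) (vertex_phase (x h k) v)) *m U g
       *m dmx (vertex_phase (x g (h * k)%g)).
  have := kappa_mx g (h * k)%g;
    rewrite mulgA (kappa_mx (g * h)%g k) (kappa_mx g h) (kappa_mx h k).
  rewrite !SM S_dmx SS -!mulmxA => /(congr1 (mulmx (hmx (S (g * h)%g (U k))))).
  rewrite !(mulmxA (hmx (S (g * h)%g (U k)))) SU_unitary !mul1mx.
  move=> /(congr1 (mulmx (hmx (S g (U h))))).
  by rewrite !(mulmxA (hmx (S g (U h)))) SU_unitary !mul1mx dmx_mul.
have [v nz] := umx_col w (hrho g).
have [l1 l2 l3] := umx_labels (hrho g) nz.
have := congr1 (fun A => entry A v w) E.
rewrite !entry_muld entry_dmul entry_lmx => e0.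
have : vertex_phase (x g h) w * vertex_phase (x (g * h)%g k) w =
    sgm (anti (rho g)) (vertex_phase (x h k) v) * vertex_phase (x g (h * k)%g) w.
  by apply: (mulfI nz); rewrite [LHS]e0; ring.
have nz0 := beta_neq0; rewrite /vertex_phase !(sgmM, sgmV) /d2 l1 l2 l3 !labV.
have nzs a : sgm (anti (rho g)) (x h k a) != 0 by rewrite sgm_eq0.
move: (in1 v) (in2 v) (out v) => a b c e.
transitivity ((sgm (anti (rho g)) (x h k a) * sgm (anti (rho g)) (x h k b)
   / sgm (anti (rho g)) (x h k c) *
   (x g (h * k)%g (lab (rho g) a) * x g (h * k)%g (lab (rho g) b)
    / x g (h * k)%g (lab (rho g) c))) *
   (sgm (anti (rho g)) (x h k c) * x g (h * k)%g (lab (rho g) c)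
    / (x g h (lab (rho g) a) * x g h (lab (rho g) b) *
      (x (g * h)%g k (lab (rho g) a) * x (g * h)%g k (lab (rho g) b))))).
  by field; rewrite ?nz0 ?nzs.
by rewrite -e; field; rewrite ?nz0 ?nzs.
Qed.

Lemma labVr g a : lab (rho g) (lab (rho g^-1%g) a) = a.
Proof. by rewrite -kappa_lab mulgV lab1. Qed.

Lemma labVM g h a :
  lab (rho (g * h)^-1%g) a = lab (rho h^-1%g) (lab (rho g^-1%g) a).
Proof.
by rewrite -{1}[a](labVr g) -{1}[lab (rho g^-1%g) a](labVr h) -(kappa_lab g h) labV.
Qed.

Lemma d2_cochain_inK y g h k : (forall g h, inK (y g h)) -> inK (d2 rho y g h k).
Proof.
move=> hy; apply: inKM; last by apply: inKV; apply: inKM.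
apply: inKM => //; apply: inK_sgm.
exact: (inK_lab (hrho g^-1%g)).
Qed.

Lemma d2M (y y' : G -> G -> obj B -> K) g h k a :
  d2 rho (fun g h a => y g h a * y' g h a) g h k a =
    d2 rho y g h k a * d2 rho y' g h k a.
Proof. by rewrite /d2 sgmM !invfM; ring. Qed.

Lemma d2V (y : G -> G -> obj B -> K) g h k a :
  d2 rho (fun g h a => (y g h a)^-1) g h k a = (d2 rho y g h k a)^-1.
Proof. by rewrite /d2 sgmV !invfM !invrK. Qed.

Definition d3 (y : G -> G -> G -> obj B -> K) g h k l a :=
  sgm (anti (rho g)) (y h k l (lab (rho g^-1%g) a)) * y g (h * k)%g l a * y g h k a
  / (y (g * h)%g k l a * y g h (k * l)%g a).

Lemma d3M (y y' : G -> G -> G -> obj B -> K) g h k l a :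
  d3 (fun g h k a => y g h k a * y' g h k a) g h k l a =
    d3 y g h k l a * d3 y' g h k l a.
Proof. by rewrite /d3 sgmM !invfM; ring. Qed.

Lemma d3d2 (y : G -> G -> obj B -> K) g h k l a : (forall g h a,
  y g h a != 0) -> d3 (d2 rho y) g h k l a = 1.
Proof.
move=> nz; rewrite /d3 /d2 !(sgmM, sgmV, sgmD) labVM -!kappa_anti !mulgA.
have nzs s g' h' a' : sgm s (y g' h' a') != 0 by rewrite sgm_eq0.
by field; rewrite ?nz ?nzs.
Qed.

End SymmetryActions.

(** * The obstruction class *)

Section Obstruction.

Variables (K : numClosedFieldType) (G : groupType) (C X : ubfc K).
Variables (psi : obj C) (i : full_subcat C X) (w2 : G -> G -> bool).
Variables (rho : G -> autodata C) (eta : G -> G -> obj C -> K).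
Variables (rho' : G -> autodata X) (beta' : G -> G -> obj X -> K).
Hypothesis hC : super_modular psi.
Hypothesis hX : minimal_modular_ext i.
Hypothesis heta : Gf_sym_frac psi w2 rho eta.
Hypothesis hrho' : forall g, topological_autoeq (i psi) (rho' g).
Hypothesis hres : forall g, restricts_action i (rho' g) (rho g).
Hypothesis hbeta' : decomposes_kappa rho' beta'.
Hypothesis hbeta'psi : ~ respects_locality (i psi) (upsilon (i psi)) ->
  forall g h, beta' g h (i psi) = (-1) ^+ w2 g h.

Implicit Types (a b c : obj C) (x y : obj X).
Local Notation in1C := (@in1 (obj C) (vtx C) bd).
Local Notation in2C := (@in2 (obj C) (vtx C) bd).
Local Notation outC := (@out (obj C) (vtx C) bd).
Local Notation in1 := (@in1 (obj X) (vtx X) bd).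
Local Notation in2 := (@in2 (obj X) (vtx X) bd).
Local Notation out := (@out (obj X) (vtx X) bd).
Local Notation om := (omega_of i beta' eta).

(** The kernel of restriction to C, indexed by Z_2; through it identities between characters become
    identities of booleans. *)
Let chi (s : bool) x := if s then mutual x (i psi) else 1.

Let eta_norm g h a : `|eta g h a| = 1.
Proof. by have [_ [hp _ _] _ _] := heta; apply: hp. Qed.

Let eta_neq0 g h a : eta g h a != 0.
Proof. exact/phase_neq0/eta_norm. Qed.

Let beta_nz g h x : beta' g h x != 0.
Proof. exact: (beta_neq0 hbeta'). Qed.

(** The equation for [eta] on C and the one for [beta'] on X express the same operator product, so
    their phases agree at each vertex of C. *)
Let om_inK g h : inK (om g h).
Proof.
apply/inKP; split=> [a|w].
  by rewrite /omega_of normrM normfV eta_norm (beta_norm hbeta') divr1.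
have [[hr _ _] [_ _ h3] _ _] := heta.
have [v nz] := umx_col w (hr (g * h)%g).
have := h3 g h v w; have := kappa_umx hrho' hbeta' g h (embv i v) (embv i w).
have [_ _ ->] := hres (g * h)%g.
(* The intermediate vertices have incoming labels in C, so by fullness they are vertices of C. *)
have -> : \sum_u sgm (anti (rho' g)) (umx (rho' h) (embv i v) u) *
  umx (rho' g) u (embv i w)
  = \sum_u sgm (anti (rho g)) (umx (rho h) v u) * umx (rho g) u w.
  have [ea _ eg] := hres g; have [_ eb eh] := hres h.
  pose a := lab (rho h) (in1C v); pose b := lab (rho h) (in2C v).
  transitivity (\sum_(u | (in1 u == i a) && (in2 u == i b))
     sgm (anti (rho' g)) (umx (rho' h) (embv i v) u) * umx (rho' g) u (embv i w)).
    rewrite [RHS]big_mkcond; apply: eq_bigr => u _; case: ifP => // no.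
    apply/eqP/negPn/negP; rewrite mulf_eq0 sgm_eq0 negb_or => /andP[+ _].
    case/(umx_labels (hrho' h)) => e1 e2 _; move: no.
    by rewrite e1 e2 !embvE !eb !eqxx.
  rewrite emb_vertices big_mkcond; apply: eq_bigr => u _; rewrite ea eg eh.
  case: ifP => // no; apply/esym/eqP/negPn/negP; rewrite mulf_eq0 sgm_eq0 negb_or.
  by move=> /andP[/(umx_labels (hr h))[e1 e2 _] _]; rewrite /a /b e1 e2 !eqxx in no.
move=> e1 e2; rewrite -e2 in e1.
have n1 := eta_neq0; have n2 := beta_nz.
move: e1; rewrite /vertex_phase !embvE -!/(in1C _) -!/(in2C _) -!/(outC _).
rewrite /src1 /src2 /tgt /omega_of; move: (in1C w) (in2C w) (outC w) => a b c e1.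
have q1 : eta g h c / (eta g h a * eta g h b)
    * (beta' g h (i a) * beta' g h (i b) / beta' g h (i c)) = 1.
  by apply: (mulfI nz); rewrite mulr1 [RHS]e1; ring.
transitivity ((eta g h c / (eta g h a * eta g h b)
    * (beta' g h (i a) * beta' g h (i b) / beta' g h (i c))) *
    (beta' g h (i c) / eta g h c)); last by rewrite q1 mul1r.
by field; rewrite ?n1 ?n2.
Qed.

Let chiM s t x : chi s x * chi t x = chi (s (+) t) x.
Proof.
case: s; case: t; rewrite /chi /= ?mulr1 ?mul1r // -expr2.
exact: mutual_fermion_sq.
Qed.

Let chiV s x : (chi s x)^-1 = chi s x.
Proof.
case: s; rewrite /= ?invr1 //; have [->|->] := mutual_fermion_sign i hC x.
  exact: invr1.
exact: invrN1.
Qed.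

Let chi_inK s : inK (chi s).
Proof.
case: s; first exact/mutual_inK/emb_fermion_qdim.
by split=> [x|x y z _]; rewrite /chi ?normr1 ?mulr1.
Qed.

Let chi_emb s a : chi s (i a) = 1.
Proof. by case: s => //; apply: mutual_emb. Qed.

Let chi_inj s t : (forall x, chi s x = chi t x) -> s = t.
Proof.
have [x ex] := mutual_fermion_nontrivial hC hX.
have ne : (1 : K) <> -1.
  by move/eqP; rewrite -addr_eq0 -mulr2n pnatr_eq0.
by case: s; case: t => // /(_ x); rewrite /chi ex => // /esym.
Qed.

Let chi_sgm u s x : sgm u (chi s x) = chi s x.
Proof.
case: s; rewrite /= ?sgm1 //.
by have [->|->] := mutual_fermion_sign i hC x; rewrite ?sgm1 ?sgmN1.
Qed.

(** The actions of g and of its inverse both preserve C, hence so does the action of g on its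
    complement, the vortices. *)
Let mutual_lab g x : mutual (lab (rho' g) x) (i psi) = mutual x (i psi).
Proof.
have img k y : mutual y (i psi) = 1 -> mutual (lab (rho' k) y) (i psi) = 1.
  move=> /(mutual_fermion_eq1 hC hX)[c ->].
  by have [_ -> _] := hres k; apply: (mutual_emb i hC).
have [e|e] := mutual_fermion_sign i hC x; first by rewrite e img.
have [e'|->] := mutual_fermion_sign i hC (lab (rho' g) x); last by rewrite e.
by have := img g^-1%g _ e'; rewrite (labV hbeta') e e'.
Qed.

Let chi_lab g s x : chi s (lab (rho' g) x) = chi s x.
Proof. by case: s => //=; apply: mutual_lab. Qed.

Let chi_neq0 s x : chi s x != 0.
Proof. by case: (chi_inK s) => + _ => /(_ x)/phase_neq0. Qed.

Let d2_chi (z : G -> G -> bool) g h k x :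
  d2 rho' (fun g h => chi (z g h)) g h k x
  = chi (z h k (+) z (g * h)%g k (+) z g (h * k)%g (+) z g h) x.
Proof.
rewrite /d2 chi_sgm chi_lab invfM !chiV !chiM; congr (chi _ x).
by case: (z h k); case: (z _ k); case: (z g (h * k)%g); case: (z g h).
Qed.

Let d2_eta g h k a : d2 rho eta g h k a = 1.
Proof.
have [_ [_ h2 _] _ _] := heta; rewrite /d2 h2 divff //.
by rewrite mulf_neq0.
Qed.

Let d2_emb (y : G -> G -> obj X -> K) (z : G -> G -> obj C -> K) g h k a :
  (forall g h, extends i (y g h) (z g h)) ->
  d2 rho' y g h k (i a) = d2 rho z g h k a.
Proof.
move=> e; rewrite /d2; have [-> _ _] := hres g; have [_ -> _] := hres g^-1%g.
by rewrite !e.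
Qed.

Let d2_beta_emb g h k a : d2 rho' beta' g h k (i a) = d2 rho om g h k a.
Proof.
rewrite (d2_emb (z := fun g h a => om g h a * eta g h a)) => [|g' h' a'].
  by rewrite d2M d2_eta mulr1.
by rewrite /omega_of divfK.
Qed.

Let character_ratio z z' : inK z -> inK z' -> (forall a, z (i a) = z' (i a)) ->
  exists s, forall x, z x = z' x * chi s x.
Proof.
move=> hz hz' e; have hz'0 x : z' x != 0 by case: hz' => hp _; exact/phase_neq0/hp.
have hr : inK (fun x => z x * (z' x)^-1) by exact: inKM hz (inKV hz').
have [|h|h] := kernel_character hC hX hr; first by move=> c; rewrite e divff.
  by exists false => x; rewrite mulr1 -[LHS](divfK (hz'0 x)) h mul1r.
by exists true => x; rewrite -[LHS](divfK (hz'0 x)) h mulrC.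
Qed.

(** omega_psi is a sign because psi is its own dual. If upsilon violates locality then [beta'] and
    [eta] agree at psi, so the sign -1 occurs only when upsilon respects locality. *)
Let om_extends g h : exists z, inK z /\ extends i z (om g h).
Proof.
have om1 : om g h psi ^+ 2 = 1.
  have /inKP[_ /(_ (cup psi))] := om_inK g h;
    rewrite !labE (fermion_dual hC) -expr2 => ->.
  exact: inK_one (om_inK g h).
move/eqP: om1; rewrite sqrf_eq1 => /orP[/eqP|/eqP] e.
  exact: (extend_character hC hX (om_inK g h) e).
have ne : (1 : K) <> -1.
  by move/eqP; rewrite -addr_eq0 -mulr2n pnatr_eq0.
have [[ga [gp ga1 [_ _ gu]]]|no] :=
  EM (respects_locality (i psi) (upsilon (i psi))); last first.
  move: e; rewrite /omega_of hbeta'psi //; have [_ _ _ ->] := heta.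
  by rewrite divff ?signr_eq0.
(* [ga] and [ups] define the same natural isomorphism, so their quotient is a character; [ups] being
   a sign, the quotient is the product. Its value at psi is -1. *)
pose ups x : K := if x == i psi then -1 else 1.
have ups2 x : ups x * ups x = 1 by rewrite /ups; case: eqP => _;
  rewrite ?mulrNN mulr1.
have zK : inK (fun x => ga x * ups x).
  apply/inKP; split=> [x|v].
    by rewrite normrM gp mul1r /ups; case: eqP; rewrite ?normrN normr1.
  have := gu v v; rewrite /= eqxx !mul1r /src1 /src2 /tgt.
  rewrite -!/(ups _) => ev.
  have n1 y : ups y != 0 by apply/eqP => e0; have := ups2 y;
    rewrite e0 mul0r => /eqP; rewrite eq_sym oner_eq0.
  have n2 y : ga y != 0 by exact/phase_neq0/gp.
  move: (in1 v) (in2 v) (out v) ev => p q r ev.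
  transitivity ((ga p * ga q / ga r) * (ga r * (ups p * ups q))).
    by field; rewrite n2.
  rewrite -ev; transitivity ((ups p * ups p) * (ups q * ups q) / (ups r *
    ups r) * (ga r * ups r)).
    by field; rewrite n1.
  by rewrite !ups2 !mul1r invr1 mul1r.
have zpsi : ga (i psi) * ups (i psi) = -1 by rewrite ga1 /ups eqxx mul1r.
have zCK : inK (fun a => om g h a * (ga (i a) * ups (i a))).
  apply: inKM => //; apply/inKP; have /inKP[zp zm] := zK.
  by split=> [a|v]; [exact: zp | rewrite -!embvE].
have [|y [yK ye]] := extend_character hC hX zCK.
  by rewrite e zpsi mulrNN mulr1.
exists (fun x => y x * (ga x * ups x)^-1); split; first by apply: inKM => //;
  apply: inKV.
move=> a /=; rewrite ye mulfK //.
by case: zK => zp _; exact/phase_neq0/zp.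
Qed.

Lemma two_extensions g h :
  inK (om g h) /\
  exists z1 z2 : obj X -> K,
    [/\ inK z1 /\ extends i z1 (om g h),
        inK z2 /\ extends i z2 (om g h),
        exists x, z1 x <> z2 x,
        forall x, z2 x = z1 x * mutual x (i psi)
      & forall z, inK z -> extends i z (om g h) ->
          (forall x, z x = z1 x) \/ (forall x, z x = z2 x)].
Proof.
split=> //; have [z1 [z1K z1e]] := om_extends g h.
exists z1, (fun x => z1 x * mutual x (i psi)); split => //.
- split; first exact: inKM z1K (chi_inK true).
  by move=> a /=; rewrite (mutual_emb i hC) mulr1.
- have [x ex] := mutual_fermion_nontrivial hC hX; exists x; rewrite ex mulrN1.
  case: z1K => zp _; move/eqP; rewrite -addr_eq0 -mulr2n mulrn_eq0 /=.
  by rewrite (negbTE (phase_neq0 (zp x))).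
move=> z zK ze; have [a|s e] := character_ratio zK z1K; first by rewrite ze z1e.
by case: s e => e; [right|left] => x; rewrite e ?mulr1.
Qed.

Let chi_mutual s x : mutual x (if s then i psi else Defs.one X) = chi s x.
Proof. by case: s => //=; apply: mutual_one. Qed.

Let ext_inK om' : K_extension i om om' -> forall g h, inK (om' g h).
Proof. by move=> h g k; have [] := h g k. Qed.

Let ext_neq0 om' g h x : K_extension i om om' -> om' g h x != 0.
Proof. by move=> /ext_inK/(_ g h)[zp _]; exact/phase_neq0/zp. Qed.

Let d2_neq0 (y : G -> G -> obj X -> K) g h k x :
  (forall g h x, y g h x != 0) -> d2 rho' y g h k x != 0.
Proof.
by move=> nz; rewrite /d2 !mulf_neq0 ?invr_eq0 ?mulf_neq0 ?sgm_eq0.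
Qed.

Lemma o3_exists om' : K_extension i om om' ->
  exists o3, is_o3 i psi rho' beta' om' o3.
Proof.
move=> hom.
have ratio g h k : exists s, forall x,
    d2 rho' beta' g h k x = d2 rho' om' g h k x * chi s x.
  apply: character_ratio; first exact: (d2_inK hrho' hbeta').
    by apply: (d2_cochain_inK hrho'); apply: ext_inK.
  move=> a; rewrite d2_beta_emb (d2_emb (z := om)) // => g' h'.
  by have [] := hom g' h'.
(* The exponent is read off by a boolean test, which is sound because [chi] is injective in its
   exponent. *)
pose o g h k := [forall x,
  d2 rho' beta' g h k x == d2 rho' om' g h k x * chi true x].
have oE g h k x : d2 rho' beta' g h k x / d2 rho' om' g h k x = chi (o g h k) x.
  have nz y : d2 rho' om' g h k y != 0 by apply: d2_neq0 => *; apply: ext_neq0.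
  have [s e] := ratio g h k; rewrite e mulrC mulKf //.
  suff -> : s = o g h k by [].
  apply/idP/forallP => [ss y|h1]; first by rewrite e ss.
  apply: chi_inj => y; apply: (mulfI (nz y)).
  by rewrite -e; apply/eqP/h1.
exists o; split=> [g h k l|g h k x]; last by rewrite oE chi_mutual.
apply: chi_inj => x.
have : d3 rho' (d2 rho' beta') g h k l x = 1 by apply: (d3d2 hbeta').
have -> : d3 rho' (d2 rho' beta') g h k l x =
    d3 rho' (fun g h k x => d2 rho' om' g h k x * chi (o g h k) x) g h k l x.
  have e g' h' k' y : d2 rho' beta' g' h' k' y =
    d2 rho' om' g' h' k' y * chi (o g' h' k') y.
    by rewrite -oE mulrC divfK //; apply: d2_neq0 => *; apply: ext_neq0.
  by rewrite /d3 !e.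
rewrite d3M (d3d2 hbeta') => [|*]; last exact: ext_neq0.
rewrite mul1r /d3 chi_sgm chi_lab invfM !chiV !chiM => e.
rewrite -[RHS]/(chi false x) -[RHS]e.
by congr (chi _ x); case: (o h k l); case: (o _ k l); case: (o g _ l);
  case: (o g h (k * l)%g); case: (o g h k).
Qed.

Let is_o3E om' o g h k x : K_extension i om om' -> is_o3 i psi rho' beta' om' o ->
  d2 rho' beta' g h k x = d2 rho' om' g h k x * chi (o g h k) x.
Proof.
move=> hom [_ ho]; rewrite -chi_mutual -ho mulrC divfK //.
by apply: d2_neq0 => *; apply: ext_neq0.
Qed.

(** Two extensions of omega differ by [chi z] for a 2-cochain [z], and d turns this factor into
    [chi] of dz. *)
Lemma o3_class om1 om2 o3 o3' :
  K_extension i om om1 -> K_extension i om om2 ->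
  is_o3 i psi rho' beta' om1 o3 -> is_o3 i psi rho' beta' om2 o3' ->
  Z2_cohomologous3 o3 o3'.
Proof.
move=> h1 h2 ho ho'.
have ratio g h : exists s, forall x, om2 g h x = om1 g h x * chi s x.
  apply: character_ratio; [exact: ext_inK|exact: ext_inK|] => a.
  by have [_ ->] := h1 g h; have [_ ->] := h2 g h.
pose z g h := [forall x, om2 g h x == om1 g h x * chi true x].
have zE g h x : om2 g h x = om1 g h x * chi (z g h) x.
  have [s e] := ratio g h; rewrite e; suff -> : s = z g h by [].
  apply/idP/forallP => [ss y|hh]; first by rewrite e ss.
  apply: chi_inj => y; apply: (mulfI (ext_neq0 g h y h1)).
  by rewrite -e; apply/eqP/hh.
exists z => g h k; apply: chi_inj => x.
have n1 : d2 rho' om1 g h k x != 0 by apply: d2_neq0 => *; apply: ext_neq0.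
have e2 : d2 rho' om2 g h k x =
  d2 rho' om1 g h k x * chi (z h k (+) z (g * h)%g k (+) z g (h * k)%g (+) z g h) x.
  by rewrite -d2_chi -d2M /d2 !zE.
apply: (mulfI n1); rewrite -e2.
apply: (mulIf (chi_neq0 (o3' g h k) x)); rewrite -(is_o3E g h k x h2 ho').
by rewrite (is_o3E g h k x h1 ho) -mulrA chiM addbK.
Qed.

Lemma o3_trivial om' o3 : K_extension i om om' -> is_o3 i psi rho' beta' om' o3 ->
  Z2_coboundary3 o3 <->
  exists om1, K_extension i om om1 /\
    forall g h k x, d2 rho' beta' g h k x = d2 rho' om1 g h k x.
Proof.
move=> hom ho; split=> [[z hz]|[om1 [h1 e1]]].
  exists (fun g h x => om' g h x * chi (z g h) x); split=> [g h|g h k x].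
    split; first by apply: inKM; [exact: ext_inK | exact: chi_inK].
    by move=> a /=; rewrite chi_emb mulr1; have [_ ->] := hom g h.
  by rewrite d2M d2_chi -hz; apply: is_o3E.
(* A solution [om1] has the zero cochain as its obstruction, so independence of the extension makes
   [o3] a coboundary. *)
have ho1 : is_o3 i psi rho' beta' om1 (fun _ _ _ => false).
  split=> // g h k x; rewrite mutual_one e1 divff //.
  by apply: d2_neq0 => *; apply: ext_neq0.
have [z hz] := o3_class hom h1 ho ho1.
by exists z => g h k; rewrite -hz addbF.
Qed.

(** For eta' = beta'/omega1 the vertex equation holds because omega1 is a character, and the cocycle
    equation says Omega' = d omega1. *)
Lemma extension_sym_frac :
  (exists om1, K_extension i om om1 /\
    forall g h k x, d2 rho' beta' g h k x = d2 rho' om1 g h k x) <->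
  exists eta' : G -> G -> obj X -> K,
    [/\ sym_frac rho' eta', forall g h, extends i (eta' g h) (eta g h)
      & exists om1, K_extension i om om1 /\
          forall g h x, eta' g h x = beta' g h x / om1 g h x].
Proof.
have d2E om1 : K_extension i om om1 -> forall g h k x,
    d2 rho' (fun g h x => beta' g h x / om1 g h x) g h k x
    = d2 rho' beta' g h k x / d2 rho' om1 g h k x.
  by move=> h1 g h k x; rewrite d2M d2V.
split=> [[om1 [h1 e1]]|[eta' [[_ h2 _] _ [om1 [h1 e1]]]]].
  have n1 g h x : om1 g h x != 0 by exact: ext_neq0.
  exists (fun g h x => beta' g h x / om1 g h x); split; last by exists om1.
    split=> [g h x|g h k x|g h v w].
    - rewrite normrM normfV (beta_norm hbeta').
      by have [[zp _] _] := h1 g h; rewrite zp divr1.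
    - set y := fun g h x => beta' g h x / om1 g h x.
      have n2 g' h' x' : y g' h' x' != 0 by rewrite /y mulf_neq0 ?invr_eq0.
      have e2 : d2 rho' y g h k x = 1.
        by rewrite d2E // e1 divff //; apply: d2_neq0.
      by rewrite -[LHS](divfK (mulf_neq0 (n2 g h x) (n2 (g *
        h)%g k x))) -/(d2 rho' y g h k x) e2 mul1r.
    rewrite (kappa_umx hrho' hbeta') mulrCA.
    have [/inKP[_ hm] _] := h1 g h; rewrite /vertex_phase /src1 /src2 /tgt.
    have := hm w; move: (in1 w) (in2 w) (out w) => p q r pq.
    rewrite -[RHS]mulr1; congr (_ * _).
    transitivity (om1 g h p * om1 g h q / om1 g h r).
      by field; rewrite ?n1 ?beta_nz.
    by rewrite pq divff.
  move=> g h a; have [_ ->] := h1 g h; rewrite /omega_of invfM invrK mulrA.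
  by rewrite divff // mul1r.
exists om1; split=> // g h k x.
have n1 g' h' x' : om1 g' h' x' != 0 by exact: ext_neq0.
have n2 g' h' x' : eta' g' h' x' != 0 by rewrite e1 mulf_neq0 ?invr_eq0.
have d1 : d2 rho' eta' g h k x = 1 by rewrite /d2 h2 divff // mulf_neq0.
have nd : d2 rho' om1 g h k x != 0 by apply: d2_neq0.
rewrite -[LHS](divfK nd) -d2E //.
have -> : d2 rho' (fun g h x => beta' g h x / om1 g h x) g h k x =
  d2 rho' eta' g h k x.
  by rewrite /d2 !e1.
by rewrite d1 mul1r.
Qed.

End Obstruction.

Theorem mainTheorem11 (R : realType) (G : groupType)
    (C X : ubfc R[i]) (psi : obj C) (iota : full_subcat C X)
    (w2 : G -> G -> bool)
    (rho : G -> autodata C) (eta : G -> G -> obj C -> R[i])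
    (rho' : G -> autodata X) (beta' : G -> G -> obj X -> R[i])
    (hC : super_modular psi)
    (hX : minimal_modular_ext iota)
    (hw2 : Z2_cocycle2 w2)
    (heta : Gf_sym_frac psi w2 rho eta)
    (hrho' : forall g, topological_autoeq (iota psi) (rho' g))
    (hres : forall g, restricts_action iota (rho' g) (rho g))
    (hH2 : vanishing_H2 (iota psi) w2 rho')
    (hbeta' : decomposes_kappa rho' beta')
    (hbeta'psi : ~ respects_locality (iota psi) (upsilon (iota psi)) ->
       forall g h, beta' g h (iota psi) = (-1) ^+ w2 g h) :
  let omega := omega_of iota beta' eta in
  (forall g h,
     inK (omega g h) /\
     exists z1 z2 : obj X -> R[i],
       [/\ inK z1 /\ extends iota z1 (omega g h),
           inK z2 /\ extends iota z2 (omega g h),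
           exists a, z1 a <> z2 a,
           forall a, z2 a = z1 a * mutual a (iota psi)
         & forall z, inK z -> extends iota z (omega g h) ->
             (forall a, z a = z1 a) \/ (forall a, z a = z2 a)]) /\
  ((forall omega', K_extension iota omega omega' ->
      exists o3, is_o3 iota psi rho' beta' omega' o3) /\
   (forall omega1 omega2 o3 o3',
      K_extension iota omega omega1 -> K_extension iota omega omega2 ->
      is_o3 iota psi rho' beta' omega1 o3 ->
      is_o3 iota psi rho' beta' omega2 o3' ->
      Z2_cohomologous3 o3 o3')) /\
  (forall omega' o3,
     K_extension iota omega omega' ->
     is_o3 iota psi rho' beta' omega' o3 ->
     (Z2_coboundary3 o3 <->
        exists omega1, K_extension iota omega omega1 /\
          forall g h k a,
            d2 rho' beta' g h k a = d2 rho' omega1 g h k a) /\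
     (Z2_coboundary3 o3 <->
        exists eta' : G -> G -> obj X -> R[i],
          [/\ sym_frac rho' eta',
              forall g h, extends iota (eta' g h) (eta g h)
            & exists omega1, K_extension iota omega omega1 /\
                forall g h a, eta' g h a = beta' g h a / omega1 g h a])).
Proof.
move=> omega; split; [|split; [split|]].
- exact: (two_extensions hC hX heta hrho' hres hbeta' hbeta'psi).
- exact: (o3_exists hC hX heta hrho' hres hbeta').
- exact: (o3_class hC hX hres hbeta').
move=> omega' o3 hom ho.
have h := o3_trivial hC hX hres hbeta' hom ho.
split=> //; apply: (iff_trans h).
exact (@extension_sym_frac _ G C X psi iota eta rho' beta' hrho' hbeta').
Qed.
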